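(* Let $u : E^N \to \mathbb{R}$ be a weak KAM solution of the Hamilton--Jacobi equation $\|Du(x)\|_*^2 = 2U(x)$ of the Newtonian $N$-body problem in $E=\mathbb{R}^d$, $d\ge 2$. Then $u$ is rotation invariant if and only if all of its calibrating curves have zero angular momentum. That is, the identity $u(x)=u(R_\theta x)$ holds for every $\theta\in \mathrm{SO}(d)$ and every $x\in E^N$ if and only if for every curve $\gamma:[0,+\infty)\to E^N$ calibrating $u$ one has $C(\gamma(t),\dot\gamma(t))=0$ for all $t>0$.
   Context: Let $d\ge 2$, $E=\mathbb{R}^d$ with Euclidean inner product $\langle\cdot,\cdot\rangle$ and norm $|\cdot|$, and let $m_1,\dots,m_N>0$ be masses. For $x=(r_1,\dots,r_N)\in E^N$ the Newtonian potential is $U(x)=\sum_{i<j} \frac{m_i m_j}{|r_i-r_j|}\in(0,+\infty]$ (equal to $+\infty$ when $r_i=r_j$ for some $i\ne j$). The mass inner product on $E^N$ is $x\cdot y=\sum_{i=1}^N m_i\langle r_i,s_i\rangle$ for $x=(r_i)$, $y=(s_i)$, with norm $\|\cdot\|$. The Lagrangian is $L(x,v)=\frac12\|v\|^2+U(x)$ and the action of an absolutely continuous curve $\gamma:[a,b]\to E^N$ is $A(\gamma)=\int_a^b L(\gamma(t),\dot\gamma(t))\,dt$. The Mañé critical action potential is $\phi(x,y)=\inf A(\gamma)$, the infimum being over all absolutely continuous curves $\gamma:[a,b]\to E^N$ with $\gamma(a)=x$, $\gamma(b)=y$ and arbitrary $b-a>0$. A weak KAM solution of the Hamilton--Jacobi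 equation $\|Du(x)\|_*^2=2U(x)$ (where $\|p\|_*^2=\sum_i m_i^{-1}|p_i|^2$) is, by definition, a function $u:E^N\to\mathbb{R}$ such that: (i) $u$ is dominated, i.e. $u(y)-u(x)\le\phi(x,y)$ for all $x,y\in E^N$; (ii) for every $x\in E^N$ there is an absolutely continuous curve $\alpha:[0,\infty)\to E^N$ with $\alpha(0)=x$ that calibrates $u$. An absolutely continuous curve $\alpha:[0,\infty)\to E^N$ calibrates $u$ if $u(\alpha(0))-u(\alpha(t))=A(\alpha|_{[0,t]})$ for every $t>0$. (Calibrating curves of a weak KAM solution minimize the action, and by Marchal's theorem minimizers have no collisions in the interior of their interval of definition; hence they are smooth solutions of Newton's equations for $t>0$ and $\dot\gamma(t)$ is defined for all $t>0$.) For $\theta\in\mathrm{SO}(d)$, $R_\theta:E^N\to E^N$ is $R_\theta(r_1,\dots,r_N)=(\theta r_1,\dots,\theta r_N)$. The angular momentum of $(x,v)$ with $x=(r_j)$, $v=(v_j)\in E^N$ is $C(x,v)=\sum_{j=1}^N m_j\, r_j\wedge v_j\in\Lambda^2E$. *)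

(* Defs.v *)
From HB Require Import structures.
From mathcomp Require Import all_boot all_order all_algebra.
From mathcomp Require Import all_classical all_reals all_analysis.

Set Implicit Arguments.
Unset Strict Implicit.
Unset Printing Implicit Defensive.

Import Order.TTheory GRing.Theory Num.Theory.
Import numFieldNormedType.Exports.

Local Open Scope classical_set_scope.
Local Open Scope ring_scope.

(* A configuration x = (r_1, ..., r_N) of E^N, with E = R^d, is a matrix
   x : 'M[R]_(N, d) whose i-th row is r_i. Curves are total functions
   R -> 'M[R]_(N, d) of which only the restriction to the interval under
   consideration matters. *)

Section NBody.
Context {R : realType}.

(* Epsilon-delta absolute continuity on [a, b]; s is a finite family of
   nonoverlapping subintervals [p.1, p.2]. *)
Definition abs_cont_on (V : normedModType R) (a b : R) (f : R -> V) : Prop :=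
  forall e : R, 0 < e -> exists2 delta : R, 0 < delta &
    forall s : seq (R * R),
      all (fun p => [&& a <= p.1, p.1 < p.2 & p.2 <= b]) s ->
      pairwise (fun p q => (p.2 <= q.1) || (q.2 <= p.1)) s ->
      \sum_(p <- s) (p.2 - p.1) < delta ->
      \sum_(p <- s) `|f p.2 - f p.1| < e.

(* Absolute continuity on [0, +oo[, i.e. on each of its compact subintervals. *)
Definition abs_cont_ray (V : normedModType R) (f : R -> V) : Prop :=
  forall t : R, 0 < t -> abs_cont_on 0 t f.

Definition edot (d : nat) (r s : 'rV[R]_d) : R :=
  \sum_(k < d) r ord0 k * s ord0 k.

(* The norm `|r| of the library on 'rV[R]_d is the sup norm. *)
Definition enorm (d : nat) (r : 'rV[R]_d) : R := Num.sqrt (edot r r).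

(* The bivector r /\ v of Lambda^2 R^d, identified with the skew-symmetric
   matrix of its coordinates r_k v_l - r_l v_k. *)
Definition wedge (d : nat) (r v : 'rV[R]_d) : 'M[R]_d :=
  r^T *m v - v^T *m r.

Definition SO (d : nat) : set 'M[R]_d :=
  [set theta | theta *m theta^T = 1%:M /\ \det theta = 1].

(* The row vector of theta r_i is r_i *m theta^T. *)
Definition rotate (N d : nat) (theta : 'M[R]_d) (x : 'M[R]_(N, d)) :
  'M[R]_(N, d) := x *m theta^T.

Section Masses.
Variables (N d : nat) (m : 'I_N -> R).
Implicit Types (x y v : 'M[R]_(N, d)) (gamma : R -> 'M[R]_(N, d)).

Definition mass_dot x y : R := \sum_(i < N) m i * edot (row i x) (row i y).

Definition mass_norm x : R := Num.sqrt (mass_dot x x).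

(* At a collision the division by 0%:E in \bar R gives +oo. *)
Definition potential x : \bar R :=
  (\sum_(i < N) \sum_(j < N | (i < j)%N)
     (m i * m j)%:E / (enorm (row i x - row j x))%:E)%E.

Definition lagrangian x v : \bar R :=
  ((2^-1 * mass_norm v ^+ 2)%:E + potential x)%E.

(* The derivative of an absolutely continuous curve exists almost everywhere;
   the value of derive1 gamma on the remaining null set is irrelevant here. *)
Definition action (a b : R) gamma : \bar R :=
  (\int[lebesgue_measure]_(t in `[a, b]) lagrangian (gamma t) (derive1 gamma t))%E.

Definition action_potential x y : \bar R :=
  ereal_inf [set A : \bar R | exists a b gamma,
    [/\ a < b, abs_cont_on a b gamma, gamma a = x, gamma b = y
      & A = action a b gamma]].

Definition dominated (u : 'M[R]_(N, d) -> R) : Prop :=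
  forall x y, ((u y - u x)%:E <= action_potential x y)%E.

Definition calibrates (u : 'M[R]_(N, d) -> R) gamma : Prop :=
  abs_cont_ray gamma /\
  forall t : R, 0 < t -> (u (gamma 0) - u (gamma t))%:E = action 0 t gamma.

Definition weak_KAM (u : 'M[R]_(N, d) -> R) : Prop :=
  dominated u /\ forall x, exists2 gamma, gamma 0 = x & calibrates u gamma.

Definition angular_momentum x v : 'M[R]_d :=
  \sum_(j < N) m j *: wedge (row j x) (row j v).

End Masses.
End NBody.

Arguments SO {R} d _.

(* Main.v *)
Require Import Defs.
From HB Require Import structures.
From mathcomp Require Import all_boot all_order all_algebra.
From mathcomp Require Import all_classical all_reals all_analysis.
From mathcomp Require Import measurable_realfun ring lra.
Set Implicit Arguments.
Unset Strict Implicit.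
Unset Printing Implicit Defensive.
Import Order.TTheory GRing.Theory Num.Theory.
Import numFieldNormedType.Exports.
Local Open Scope classical_set_scope.
Local Open Scope ring_scope.

(** Write R_s for the rotation of angle s in a coordinate plane, J for its
    generator, and G for the velocity of a curve gamma. Turning gamma at constant
    angular velocity b replaces its Lagrangian 1/2 |G|^2 + U by
    1/2 |G + b J gamma|^2 + U, because U and the mass inner product are invariant
    under rotations. The term linear in b is b (J gamma . G), up to sign a
    component of the angular momentum. Domination, applied to the turned curve run
    backwards, gives the single inequality that carries both implications
    (dominated_turning): on [0, T],
      u (R_a gamma(0)) - u (R_(a + bT) gamma(T)) <= action of the turned curve.

    Suppose first that calibrating curves have zero angular momentum. Let gamma
    calibrate u from x, and take a = s, b = - s, T = 1. The turned curve joins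
    R_s x to gamma(1) and its action exceeds that of gamma by a multiple of s^2
    only, whence u (R_s x) <= u x + K s^2 (rotation_superdiff). So the function
    s |-> u (R_s x) lies below a parabola with horizontal tangent at each of its
    points. If U(x) is finite it is also Lipschitz (rotation_lipschitz), hence
    almost everywhere differentiable with derivative 0, hence constant. A
    collision x is reached through a nearby point without collision on a
    calibrating curve (rotation_invariant_plane). Plane rotations generate SO(d)
    (SO_ind).

    Suppose now that u is rotation invariant and that gamma calibrates u. For
    a = 0 the left-hand side above is the action of gamma, whatever b is. So the
    action of the turned curve, a quadratic polynomial in b, is smallest at b = 0,
    and J gamma . G has integral 0 on [0, T], for every T (integral_torque). At
    each time where gamma is differentiable this implies J gamma . gamma' = 0
    (torque_eq0); at the other times derive1 takes the default value 0.

    The link between increments and derivatives of absolutely continuous curves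
    used throughout is abs_cont_FTC, obtained from the theorems of Radon-Nikodym
    and Lebesgue. *)

(** * Absolutely continuous functions *)

Section AbsCont.
Context {R : realType}.
Implicit Types (a b : R).

Definition admissible a b (s : seq (R * R)) :=
  all (fun p => [&& a <= p.1, p.1 < p.2 & p.2 <= b]) s /\
  pairwise (fun p q => (p.2 <= q.1) || (q.2 <= p.1)) s.

Lemma abs_cont_on_sub (V : normedModType R) a b a' b' (f : R -> V) :
  a <= a' -> b' <= b -> abs_cont_on a b f -> abs_cont_on a' b' f.
Proof.
move=> aa bb fac e e0; have [de de0 H] := fac e e0.
exists de => // s sall; apply: H.
apply: sub_all sall => p /and3P[p1 p2 p3]; apply/and3P; split => //.
  exact: le_trans p1.
exact: le_trans p3 bb.
Qed.

Lemma abs_cont_on_dom (V W : normedModType R) a b C (f : R -> V) (g : R -> W) :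
  (forall x y, a <= x -> x < y -> y <= b ->
     `|f y - f x| <= C * `|g y - g x|) ->
  abs_cont_on a b g -> abs_cont_on a b f.
Proof.
move=> fg gac e e0.
have C0 : 0 < Num.max C 1 by rewrite lt_max ltr01 orbT.
have [de de0 H] := gac (e / Num.max C 1) (divr_gt0 e0 C0).
exists de => // s sall spair slen.
have := H s sall spair slen; rewrite ltr_pdivlMr//; apply: le_lt_trans.
rewrite mulr_suml big_seq [leRHS]big_seq; apply: ler_sum => p ps.
have /and3P[p1 p2 p3] := allP sall _ ps.
apply: le_trans (fg _ _ p1 p2 p3) _.
by rewrite mulrC ler_wpM2l// le_max lexx.
Qed.

Lemma abs_cont_on_id a b : abs_cont_on a b (@idfun R).
Proof.
move=> e e0; exists e => // s sall _; rewrite big_seq.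
under eq_bigr => p ps do rewrite -[p.2 - p.1]gtr0_norm
  ?subr_gt0 ?(andP (andP (allP sall _ ps)).2).1//.
rewrite -big_seq//.
Qed.

Lemma abs_cont_on_lip (V : normedModType R) a b C (f : R -> V) :
  (forall x y, a <= x -> x < y -> y <= b -> `|f y - f x| <= C * (y - x)) ->
  abs_cont_on a b f.
Proof.
move=> H; apply: (abs_cont_on_dom (C := C)) (abs_cont_on_id a b).
by move=> x y ax xy yb; rewrite /= gtr0_norm ?subr_gt0// H.
Qed.

Lemma abs_cont_on_le2 (V W X : normedModType R) a b (f : R -> V) (g : R -> W)
    (h : R -> X) :
  (forall x y, a <= x -> x < y -> y <= b ->
     `|f y - f x| <= `|g y - g x| + `|h y - h x|) ->
  abs_cont_on a b g -> abs_cont_on a b h -> abs_cont_on a b f.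
Proof.
move=> fgh gac hac e e0.
have e20 : 0 < e / 2 by rewrite divr_gt0.
have [d1 d10 H1] := gac _ e20; have [d2 d20 H2] := hac _ e20.
exists (Num.min d1 d2); first by rewrite lt_min d10.
move=> s sall spair; rewrite lt_min => /andP[s1 s2].
rewrite [e]splitr.
apply: le_lt_trans (ltrD (H1 s sall spair s1) (H2 s sall spair s2)).
rewrite -big_split/= big_seq [leRHS]big_seq; apply: ler_sum => p ps.
by have /and3P[p1 p2 p3] := allP sall _ ps; exact: fgh.
Qed.

Lemma abs_cont_onD (V : normedModType R) a b (f g : R -> V) :
  abs_cont_on a b f -> abs_cont_on a b g -> abs_cont_on a b (fun t => f t + g t).
Proof.
apply: abs_cont_on_le2 => x y _ _ _.
by rewrite opprD addrACA ler_normD.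
Qed.

Lemma abs_cont_on_cst (V : normedModType R) a b (c : V) :
  abs_cont_on a b (fun=> c).
Proof.
by apply: (abs_cont_on_lip (C := 0)) => x y _ _ _; rewrite subrr normr0 mul0r.
Qed.

Lemma abs_cont_on_sum (V : normedModType R) (I : Type) (r : seq I) (P : pred I)
    a b (f : I -> R -> V) :
  (forall i, P i -> abs_cont_on a b (f i)) ->
  abs_cont_on a b (fun t => \sum_(i <- r | P i) f i t).
Proof.
move=> fac; elim: r => [|i r IH].
  under [X in abs_cont_on _ _ X]eq_fun do rewrite big_nil.
  exact: abs_cont_on_cst.
under [X in abs_cont_on _ _ X]eq_fun do rewrite big_cons.
have := fac i; case: (P i) => // fi.
exact: (abs_cont_onD (fi erefl) IH).
Qed.

Lemma abs_cont_on_unif (V : normedModType R) a b (f : R -> V) (e : R) :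
  abs_cont_on a b f -> 0 < e -> exists2 de, 0 < de &
  forall x y, a <= x -> x < y -> y <= b -> y - x < de -> `|f y - f x| < e.
Proof.
move=> fac e0; have [de de0 H] := fac e e0; exists de => // x y ax xy yb yx.
have := H [:: (x, y)]; rewrite !big_cons !big_nil !addr0 /= ax xy yb.
exact.
Qed.

End AbsCont.

(** * Total variation of absolutely continuous functions *)

Section TV.
Context {R : realType}.
Implicit Types (a b : R) (f : R -> R).
Notation TV := total_variation.
Notation BV := bounded_variation.

(** The increments of a partition as a family of intervals: the form in which
    absolute continuity bounds a variation. *)
Definition pieces (x : R) (t : seq R) := zip (x :: t) t.

Lemma pieces_spec x t y : itv_partition x y t ->
  [/\ admissible x y (pieces x t),
      \sum_(p <- pieces x t) (p.2 - p.1) = y - x &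
      forall f, \sum_(p <- pieces x t) `|f p.2 - f p.1| = variation x y f t].
Proof.
move=> xyt; split; last first.
- move=> f; rewrite (variation_zip f xyt) /pieces.
  move: (x :: t) => l; clear xyt.
  by elim: l t => [|z s IH] [|w u]; rewrite ?big_nil //= ?big_cons/= ?IH.
- case: xyt => _ /eqP <-; rewrite /pieces.
  elim: t x => [|z t IH] x /=; first by rewrite big_nil subrr.
  by rewrite big_cons/= IH addrC addrA subrK.
elim: t x xyt => [|z t IH] x xyt; first by split.
have [[/= /andP[xz _]] _] := xyt.
have [al pw] := IH z (itv_partition_cons xyt).
have zy := itv_partition_le (itv_partition_cons xyt).
split.
  rewrite /= lexx xz zy/=.
  apply: sub_all al => p /and3P[p1 p2 p3]; apply/and3P; split => //.
  exact: le_trans (ltW xz) p1.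
rewrite /= pw andbT; apply/allP => p /(allP al)/and3P[p1 _ _] /=.
by rewrite p1.
Qed.

(** The intervals are refined one at a time: s holds those whose variation
    still has to be expanded into a supremum over partitions, r the increments
    already obtained from chosen partitions. *)
Lemma total_variation_sum_le a b f (e de : R) :
  (forall s, admissible a b s -> \sum_(p <- s) (p.2 - p.1) < de ->
    \sum_(p <- s) `|f p.2 - f p.1| <= e) ->
  forall s r, admissible a b (s ++ r) ->
    \sum_(p <- s ++ r) (p.2 - p.1) < de ->
    (\sum_(p <- s) TV p.1 p.2 f + (\sum_(p <- r) `|f p.2 - f p.1|)%:E <= e%:E)%E.
Proof.
move=> H; elim=> [|p s IH] r [al pw] len.
  by rewrite big_nil add0e lee_fin; exact: H.
move: al => /= /andP[/and3P[p1 p2 p3] al].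
move: pw => /= /andP[pal pw].
rewrite big_cons -addeA.
have key t : itv_partition p.1 p.2 t ->
    (\sum_(q <- s) TV q.1 q.2 f +
      (variation p.1 p.2 f t + \sum_(q <- r) `|f q.2 - f q.1|)%:E <= e%:E)%E.
  move=> pt; have [[tal tpw] tlen tvar] := pieces_spec pt.
  rewrite -tvar -big_cat/=; apply: IH; last first.
    by move: len; rewrite /= big_cons !big_cat /= tlen addrCA.
  move: al; rewrite all_cat => /andP[sal ral].
  move: pal; rewrite all_cat => /andP[psal pral].
  move: pw; rewrite pairwise_cat => /and3P[srel spw rpw].
  split.
    rewrite !all_cat sal ral /= andbT.
    apply: sub_all tal => q /and3P[q1 q2 q3]; apply/and3P; split => //.
      exact: le_trans p1 q1.
    exact: le_trans q3 p3.
  rewrite !pairwise_cat allrel_catr srel spw rpw tpw /= !andbT.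
  apply/andP; split; apply/allrelP => x y xi yi.
    have /and3P[y1 y2 y3] := allP tal _ yi.
    have /orP[h|h] := allP psal _ xi.
      by rewrite (le_trans y3 h) orbT.
    by rewrite (le_trans h y1).
  have /and3P[x1 x2 x3] := allP tal _ xi.
  have /orP[h|h] := allP pral _ yi.
    by rewrite (le_trans x3 h).
  by rewrite (le_trans h x1) orbT.
have S0 : (0 <= \sum_(q <- s) TV q.1 q.2 f)%E.
  rewrite big_seq; apply: sume_ge0 => q qs.
  move: al; rewrite all_cat => /andP[/allP/(_ _ qs)/and3P[_ q2 _] _].
  exact/total_variation_ge0/ltW.
have Sfin : (\sum_(q <- s) TV q.1 q.2 f)%E \is a fin_num.
  rewrite ge0_fin_numE//.
  have := key _ (itv_partition1 p2).
  apply: contra_leT; rewrite ltey negbK => /eqP ->.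
  by rewrite addye// ltry.
rewrite addeA (addeC (TV _ _ _)) -addeA -leeBrDl// -leeBrDr//.
apply: ge_ereal_sup => _ [_ [t pt <-] <-].
by rewrite leeBrDr// leeBrDl// -EFinD; exact: key.
Qed.

(** Cut [a, b] into pieces shorter than the delta of epsilon = 1: the
    variation over each piece is at most 1. *)
Lemma abs_cont_on_BV a b f : a <= b -> abs_cont_on a b f ->
  TV a b f \is a fin_num.
Proof.
move=> ab fac; have [de de0 H] := fac 1 ltr01.
have step x y : a <= x -> x < y -> y <= b -> y - x < de -> (TV x y f <= 1)%E.
  move=> ax xy yb yx.
  have := @total_variation_sum_le a b f 1 de _ [:: (x, y)] [::].
  rewrite !big_cons !big_nil /= !adde0 addr0; apply => //.
    by move=> s [al pw] len; exact/ltW/H.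
  by split; rewrite //= ax xy yb.
have [n nP] : exists n : nat, b - a < de * n.+1%:R.
  exists (Num.truncn ((b - a) / de)).
  by rewrite mulrC -ltr_pdivrMr//; apply: truncnS_gt.
have n0 : (0 : R) < n.+1%:R by [].
pose h := (b - a) / n.+1%:R.
have h0 : 0 <= h by rewrite divr_ge0// subr_ge0.
have hde : h < de by rewrite ltr_pdivrMr.
have bE : b = a + h * n.+1%:R by rewrite divfK ?gt_eqF// subrKC.
have : forall k, (k <= n.+1)%N -> TV a (a + h * k%:R) f \is a fin_num.
  elim=> [|k IH] kn; first by rewrite mulr0 addr0 total_variationxx.
  have [h00|] := eqVneq h 0; first by rewrite h00 mul0r addr0 total_variationxx.
  move=> hn0; have hp : 0 < h by rewrite lt_neqAle eq_sym hn0.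
  have ak : a <= a + h * k%:R by rewrite lerDl mulr_ge0.
  have akk : a + h * k%:R < a + h * k.+1%:R by rewrite ltrD2l ltr_pM2l// ltr_nat.
  rewrite (total_variationD f ak (ltW akk)) fin_numD IH ?(ltnW kn)//=.
  rewrite ge0_fin_numE; last exact/total_variation_ge0/ltW.
  apply: (@le_lt_trans _ _ 1%E); last by rewrite ltry.
  apply: step => //; first by rewrite [leRHS]bE lerD2l ler_wpM2l// ler_nat.
  by rewrite -natr1 mulrDr mulr1 [ltLHS](_ : _ = h)//; ring.
by move=> /(_ n.+1 (leqnn _)); rewrite -bE.
Qed.

Definition var_fun a f (x : R) : R := fine (TV a x f).

Lemma total_variation_fin_sub a b f x y : TV a b f \is a fin_num -> a <= x ->
  x <= y -> y <= b -> TV x y f \is a fin_num.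
Proof.
move=> fin ax xy yb; have xb := le_trans xy yb; have ay := le_trans ax xy.
move: fin; rewrite (total_variationD f ax xb) (total_variationD f xy yb).
by rewrite !fin_numD => /and3P[].
Qed.

Lemma var_funB a b f x y : TV a b f \is a fin_num -> a <= x ->
  x <= y -> y <= b -> (var_fun a f y - var_fun a f x)%:E = TV x y f.
Proof.
move=> fin ax xy yb; have xb := le_trans xy yb; have ay := le_trans ax xy.
rewrite /var_fun (total_variationD f ax xy) fineD.
- rewrite addrC addKr fineK//; exact: total_variation_fin_sub fin _ _ _.
- exact: total_variation_fin_sub fin _ _ _.
- exact: total_variation_fin_sub fin _ _ _.
Qed.

Lemma var_fun_ge a b f x y : TV a b f \is a fin_num -> a <= x ->
  x <= y -> y <= b -> `|f y - f x| <= var_fun a f y - var_fun a f x.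
Proof.
move=> fin ax xy yb; rewrite -lee_fin (var_funB fin)//.
exact: total_variation_ge.
Qed.

(** The delta that controls the increments of f also controls those of its
    variation, since the condition is stable under refining the intervals. *)
Lemma abs_cont_on_var_fun a b f : a <= b -> abs_cont_on a b f ->
  abs_cont_on a b (var_fun a f).
Proof.
move=> ab fac e e0; have fin := abs_cont_on_BV ab fac.
have e20 : 0 < e / 2 by rewrite divr_gt0.
have [de de0 H] := fac _ e20; exists de => // s al pw len.
apply: (@le_lt_trans _ _ (e / 2)); last by rewrite gtr_pMr// invf_lt1// ltr1n.
rewrite -lee_fin -sumEFin.
have := @total_variation_sum_le a b f (e / 2) de _ s [::].
rewrite cats0 big_nil adde0 => /(_ _ (conj al pw) len).
have -> : (\sum_(p <- s) TV p.1 p.2 f =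
    \sum_(p <- s) (`|var_fun a f p.2 - var_fun a f p.1|)%:E)%E.
  rewrite big_seq [RHS]big_seq; apply: eq_bigr => p ps.
  have /and3P[p1 p2 p3] := allP al _ ps.
  rewrite ger0_norm ?(var_funB fin p1 (ltW p2) p3)//.
  by rewrite (le_trans _ (var_fun_ge fin p1 (ltW p2) p3)).
by apply=> t [? ?] ?; exact/ltW/H.
Qed.

Lemma abs_cont_on_bounded a b f : a <= b -> abs_cont_on a b f ->
  exists2 M, 0 <= M & forall x, a <= x <= b -> `|f x| <= M.
Proof.
move=> ab fac; have fin := abs_cont_on_BV ab fac.
exists (`|f a| + var_fun a f b).
  by rewrite addr_ge0// fine_ge0// total_variation_ge0.
move=> x /andP[ax xb]; rewrite -(subrK (f a) (f x)) addrC.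
rewrite (le_trans (ler_normD _ _))// lerD2l.
rewrite (le_trans (var_fun_ge fin (lexx _) ax xb))//.
rewrite (@le_trans _ _ (var_fun a f x))//.
  by rewrite gerBl// fine_ge0// total_variation_ge0.
by rewrite -subr_ge0 (le_trans _ (var_fun_ge fin ax xb (lexx _))).
Qed.

Lemma abs_cont_onM a b f g : a <= b -> abs_cont_on a b f -> abs_cont_on a b g ->
  abs_cont_on a b (fun t => f t * g t).
Proof.
move=> ab fac gac.
have [M M0 fM] := abs_cont_on_bounded ab fac.
have [K K0 gK] := abs_cont_on_bounded ab gac.
apply: (@abs_cont_on_le2 _ _ _ _ _ _ _ (fun t => M * g t) (fun t => K * f t)).
- move=> x y ax xy yb.
  rewrite -!mulrBr !normrM (ger0_norm M0) (ger0_norm K0).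
  rewrite (_ : _ - _ = f y * (g y - g x) + g x * (f y - f x)); last by ring.
  rewrite (le_trans (ler_normD _ _))// !normrM lerD// ler_wpM2r//.
    by apply: fM; rewrite yb (le_trans ax (ltW xy)).
  by apply: gK; rewrite ax (le_trans (ltW xy) yb).
- apply: (abs_cont_on_dom (C := M)) gac => x y _ _ _.
  by rewrite -mulrBr normrM (ger0_norm M0).
- apply: (abs_cont_on_dom (C := K)) fac => x y _ _ _.
  by rewrite -mulrBr normrM (ger0_norm K0).
Qed.

End TV.

(** * The fundamental theorem of calculus for absolutely continuous functions *)

Section Decomp.
Context {R : realType}.
Implicit Types (F : nat -> set R) (s : seq (R * R)).

Definition itv_union s : set R := \bigcup_(p in [set` s]) [set` `]p.1, p.2]].

(** Absolute continuity speaks of nonoverlapping intervals, whereas the covers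
    given by the Lebesgue outer measure may overlap. *)
Lemma ocitv_bigcup_disjoint F n : (forall k, ocitv (F k)) ->
  exists s, [/\ all (fun p => p.1 < p.2) s,
    pairwise (fun p q => (p.2 <= q.1) || (q.2 <= p.1)) s &
    \big[setU/set0]_(k < n) F k = itv_union s].
Proof.
move=> oF.
have : measurable (\big[setU/set0]_(k < n) F k : set (SetRing.type (ocitv_type R))).
  apply: bigsetU_measurable => k _; apply: SetRing.measurable_subring; exact: oF.
rewrite SetRing.ring_measurableE => -[B [-> Bm Bfin Btriv]].
have [s0 s0u s0B] : exists2 s0 : seq (set R), uniq s0 & B = [set` s0].
  have /finite_seqP[s1 ->] := Bfin.
  by exists (undup s1); [exact: undup_uniq|apply/seteqP; split=> x /=; rewrite mem_undup].
have /choice[pp ppP] : forall X, exists q : R * R, B X -> X !=set0 ->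
    q.1 < q.2 /\ X = [set` `]q.1, q.2]].
  move=> X; have [BX|nBX] := pselect (B X); last by exists (0, 0).
  have [X0|nX0] := pselect (X !=set0); last by exists (0, 0).
  have /ocitvP[XE|[x x12 XE]] := Bm _ BX; last by exists x.
  by case: X0 => x; rewrite XE.
pose s1 := [seq X <- s0 | `[<X !=set0>]].
have s1P X : X \in s1 -> B X /\ X !=set0.
  by rewrite mem_filter s0B => /andP[/asboolP].
exists (map pp s1); split.
- rewrite all_map; apply/allP => X /s1P[BX X0] /=.
  by have [] := ppP X BX X0.
- have : uniq s1 by exact: filter_uniq.
  elim: (s1) s1P => //= X t IH tP /andP[Xt ut]; rewrite IH// ?andbT; last first.
    by move=> Y Yt; apply: tP; rewrite inE Yt orbT.
  rewrite all_map; apply/allP => Y Yt /=.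
  have [BX X0] := tP X (mem_head _ _).
  have [BY Y0] := tP Y (mem_behead (s := X :: t) Yt).
  have [X12 XE] := ppP _ BX X0; have [Y12 YE] := ppP _ BY Y0.
  apply: contraT; rewrite negb_or -!ltNge => /andP[h1 h2].
  have : X `&` Y !=set0.
    exists (Num.min (pp X).2 (pp Y).2); split.
      suff : [set` `](pp X).1, (pp X).2]] (Num.min (pp X).2 (pp Y).2) by rewrite -XE.
      by rewrite /= in_itv/=; apply/andP; split; [by rewrite lt_min X12 h2|by rewrite ge_min lexx].
    suff : [set` `](pp Y).1, (pp Y).2]] (Num.min (pp X).2 (pp Y).2) by rewrite -YE.
    by rewrite /= in_itv/=; apply/andP; split; [rewrite lt_min Y12 h1|rewrite ge_min lexx orbT].
  by move=> /(Btriv _ _ BX BY) XY; move: Xt; rewrite XY Yt.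
- apply/seteqP; split=> x.
    move=> [X BX Xx]; have X0 : X !=set0 by exists x.
    have [X12 XE] := ppP _ BX X0.
    exists (pp X); last by rewrite -XE.
    by rewrite /= map_f// mem_filter; apply/andP; split; [exact/asboolP|rewrite s0B in BX].
  move=> [p /= /mapP[X /s1P[BX X0] ->]] Xx; exists X => //.
  by have [X12 ->] := ppP _ BX X0.
Qed.

Lemma measure_itv_union (nu : {measure set (measurableTypeR R) -> \bar R}) s :
  all (fun p => p.1 < p.2) s ->
  pairwise (fun p q => (p.2 <= q.1) || (q.2 <= p.1)) s ->
  nu (itv_union s) = (\sum_(p <- s) nu [set` `]p.1, p.2]])%E.
Proof.
rewrite /itv_union; elim: s => [_ _|p s IH]/=.
  by rewrite big_nil bigcup0// measure0.
move=> /andP[p12 sal] /andP[pal spw]; rewrite big_cons -IH//.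
have -> : [set` p :: s] = p |` [set` s].
  by apply/seteqP; split=> q /=; rewrite inE => /predU1P.
rewrite bigcup_setU1 measureU//.
- by apply: fin_bigcup_measurable => // q _; exact: measurable_itv.
- apply/seteqP; split=> // x [/= xp [q /= qs xq]].
  move: xp xq; rewrite !in_itv/= => /andP[p1 p2] /andP[q1 q2].
  have /orP[h|h] := allP pal _ qs.
    by have := lt_le_trans q1 (le_trans p2 h); rewrite ltxx.
  by have := lt_le_trans p1 (le_trans q2 h); rewrite ltxx.
Qed.

End Decomp.

Section Density.
Context {R : realType}.
Notation mu := (@lebesgue_measure R).

Lemma lebesgue_null_cover (A : set R) (e : R) : measurable A -> mu A = 0%E ->
  0 < e -> exists F : nat -> set R, [/\ forall k, ocitv (F k),
    A `<=` \bigcup_k F k &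
    forall n, (mu (\big[setU/set0]_(k < n) F k) < e%:E)%E].
Proof.
move=> mA A0 e0.
have /ereal_inf_lt[z [/= F [mF AF] sFz zDe]] : (mu A < mu A + e%:E)%E.
  by rewrite A0 add0e lte_fin.
exists F; split => // n.
have mF' k : measurable (F k : set (measurableTypeR R)).
  by apply: sub_sigma_algebra; exact: mF.
rewrite A0 add0e in zDe; apply: le_lt_trans zDe.
rewrite -sFz; apply: (@le_trans _ _ (\sum_(k < n) mu (F k))%E).
  exact: Boole_inequality.
rewrite -(big_mkord xpredT (fun k => mu (F k))).
apply: (@le_trans _ _ (\sum_(0 <= k <oo) mu (F k))%E).
  by apply: nneseries_lim_ge => k _ _; exact: measure_ge0.
apply: lee_nneseries => [k _ _|k _]; first exact: measure_ge0.
have /ocitvP[->|[[p q] /= pq ->]] : ocitv (F k) by exact: mF.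
  by rewrite measure0 wlength0.
by rewrite lebesgue_measure_itv wlength_itv.
Qed.

Lemma lebesgue_stieltjes_itv_oc (f : cumulative R R) x y : x <= y ->
  lebesgue_stieltjes_measure f `]x, y] = (f y - f x)%:E.
Proof.
move=> xy; rewrite /lebesgue_stieltjes_measure /measure_extension/=.
rewrite measurable_mu_extE//; last exact: is_ocitv.
exact: wlength_itv_bnd.
Qed.

Section Clamp.
Variables (a b : R).
Hypothesis ab : a <= b.

Definition clamp (x : R) := Num.max a (Num.min x b).

Lemma clamp_in x : clamp x \in `[a, b].
Proof. by rewrite in_itv/= /clamp le_max lexx/= ge_max ab/= ge_min lexx orbT. Qed.

Lemma clamp_id x : a <= x <= b -> clamp x = x.
Proof.
by move=> /andP[ax xb]; rewrite /clamp (min_idPl xb) (max_idPr ax).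
Qed.

Lemma clamp_le x y : x <= y -> clamp x <= clamp y.
Proof.
rewrite /clamp /Num.max /Num.min => xy.
by case: (ltP x b) => ?; case: (ltP y b) => ?; case: ltP => ?; case: ltP => ?; lra.
Qed.

Lemma clamp_dist x y : x <= y -> clamp y - clamp x <= y - x.
Proof.
rewrite /clamp /Num.max /Num.min => xy.
by case: (ltP x b) => ?; case: (ltP y b) => ?; case: ltP => ?; case: ltP => ?; lra.
Qed.

Lemma clamp_continuous (f : R -> R) : abs_cont_on a b f -> continuous (f \o clamp).
Proof.
move=> fac x; apply/cvgrPdist_lt => /= e e0.
have [de de0 H] := abs_cont_on_unif fac e0.
have K y z : y <= z -> z - y < de -> `|f (clamp z) - f (clamp y)| < e.
  move=> yz zy; have := clamp_le yz; rewrite le_eqVlt => /predU1P[->|lt].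
    by rewrite subrr normr0.
  have := clamp_in y; have := clamp_in z; rewrite !in_itv/= => /andP[_ ?] /andP[? _].
  by apply: H => //; apply: le_lt_trans zy; exact: clamp_dist.
near=> y.
have yx : `|x - y| < de by near: y; exact: cvgr_dist_lt.
have [xy|/ltW xy] := leP x y.
  by rewrite distrC K// -[ltLHS]ger0_norm ?subr_ge0// distrC.
by rewrite K// -[ltLHS]ger0_norm ?subr_ge0.
Unshelve. all: by end_near. Qed.

End Clamp.

Section Monotone.
Variables (a b : R) (F : R -> R).
Hypothesis ab : a < b.
Hypothesis Fnd : {in `[a, b] &, {homo F : x y / x <= y}}.
Hypothesis Fac : abs_cont_on a b F.

(** F extended by constants, which makes it a cumulative function on the whole
    line. *)
Definition cl_fun (x : R) := F (clamp a b x).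

Let cl_nd : {homo cl_fun : x y / x <= y}.
Proof. by move=> x y xy; apply: Fnd; rewrite ?clamp_in ?(ltW ab)//; exact: clamp_le. Qed.

Let cl_rc : right_continuous cl_fun.
Proof.
by apply: right_continuousW => x; apply: (clamp_continuous (ltW ab) Fac).
Qed.

Let cl_cumulative := isCumulative.Build R _ R cl_fun cl_nd cl_rc.
Let cl : cumulative R R := HB.pack cl_fun cl_cumulative.

Let nu : {measure set (measurableTypeR R) -> \bar R} := lebesgue_stieltjes_measure cl.

Let nu_oc x y : x <= y -> nu `]x, y]%classic = (cl_fun y - cl_fun x)%:E.
Proof. exact: (lebesgue_stieltjes_itv_oc cl). Qed.

Let mI : measurable (`]a, b] : set (measurableTypeR R)).
Proof. exact: measurable_itv. Qed.

Let nuI_fin : (nu `]a, b]%classic < +oo)%E.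
Proof. by rewrite nu_oc ?ltry// ltW. Qed.

Let nuI : {finite_measure set (measurableTypeR R) -> \bar R} := mfrestr mI nuI_fin.

(** A Lebesgue-null set has covers of total length below delta; every finite
    part of such a cover is a disjoint union of intervals whose F-increments add
    up to less than epsilon. *)
Let nuI_ac : nuI `<< mu.
Proof.
apply/null_content_dominatesP => A mA A0.
have mAI : measurable (A `&` `]a, b] : set (measurableTypeR R)) by exact: measurableI.
have AI0 : mu (A `&` `]a, b]) = 0%E.
  by apply: (subset_measure0 (B := A)) => //; apply: subIsetl.
rewrite /nuI /= /mfrestr /mrestr.
apply/eqP; rewrite eq_le measure_ge0 andbT; apply/lee_addgt0Pr => /= e e0.
rewrite add0e.
have [de de0 H] := Fac e0.
have [G0 [oG0 AG0 lenG0]] := lebesgue_null_cover mAI AI0 de0.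
pose G k := G0 k `&` `]a, b].
have oG k : ocitv (G k) by apply: ocitvI => //; exact: is_ocitv.
have mG k : measurable (G k : set (measurableTypeR R)).
  by apply: sub_sigma_algebra; exact: oG.
have mG0 k : measurable (G0 k : set (measurableTypeR R)).
  by apply: sub_sigma_algebra; exact: oG0.
have AG : A `&` `]a, b] `<=` \bigcup_k G k.
  by move=> x Ax; have [k _ Gk] := AG0 _ Ax; exists k => //; split => //; case: Ax.
have small n : (nu (\big[setU/set0]_(k < n) G k) <= e%:E)%E.
  have [s [sal spw sE]] := ocitv_bigcup_disjoint n oG.
  rewrite sE measure_itv_union//.
  have sin : all (fun p => [&& a <= p.1, p.1 < p.2 & p.2 <= b]) s.
    apply/allP => p ps; have p12 := allP sal _ ps; rewrite p12/=.
    have sub : [set` `]p.1, p.2]] `<=` `]a, b]%classic.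
      move=> x px; have : itv_union s x by exists p.
      by rewrite -sE -bigcup_mkord => -[k _ []].
    apply/andP; split.
      rewrite leNgt; apply/negP => pa.
      have : [set` `]p.1, p.2]] (Num.min a p.2).
        by rewrite /= in_itv/=; apply/andP; split; [rewrite lt_min pa p12|rewrite ge_min lexx orbT].
      by move=> /sub; rewrite /= in_itv/= lt_min ltxx.
    have /sub : [set` `]p.1, p.2]] p.2 by rewrite /= in_itv/= p12 lexx.
    by rewrite /= in_itv/= => /andP[].
  have len : \sum_(p <- s) (p.2 - p.1) < de.
    rewrite -lte_fin -sumEFin.
    apply: le_lt_trans (lenG0 n).
    apply: (@le_trans _ _ (mu (\big[setU/set0]_(k < n) G k))).
      rewrite sE measure_itv_union// big_seq [leRHS]big_seq.
      apply: lee_sum => p ps; rewrite [leRHS](lebesgue_measure_itv `]p.1, p.2])/= lte_fin.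
      by rewrite (allP sal _ ps) EFinB.
    apply: le_measure; rewrite ?inE.
    - exact: bigsetU_measurable.
    - exact: bigsetU_measurable.
    - by rewrite -!bigcup_mkord; apply: subset_bigcup => k _; exact: subIsetl.
  apply: (@le_trans _ _ (\sum_(p <- s) `|F p.2 - F p.1|)%:E); last first.
    by rewrite lee_fin; exact/ltW/(H s sin spw len).
  rewrite -sumEFin big_seq [leRHS]big_seq; apply: lee_sum => p ps.
  have /and3P[p1 p12 p2] := allP sin _ ps.
  rewrite nu_oc ?(ltW p12)// lee_fin /cl_fun !clamp_id ?p1 ?p2 ?(ltW p12)//=.
  - exact: ler_norm.
  - by rewrite (le_trans (ltW p12) p2).
  - by rewrite (le_trans p1 (ltW p12)).
apply: (@le_trans _ _ (nu (\bigcup_k G k))).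
  by apply: le_measure; rewrite ?inE//; exact: bigcupT_measurable.
rewrite -bigcup_bigsetU_bigcup.
have mU n : measurable (\big[setU/set0]_(k < n.+1) G k : set (measurableTypeR R)).
  exact: bigsetU_measurable.
have := @nondecreasing_cvg_mu _ _ _ nu (fun n => \big[setU/set0]_(k < n.+1) G k) mU.
move=> /(_ (bigcupT_measurable _ mU)) /(_ _)/wrap[].
  by move=> m n mn; apply/subsetPset; exact: subset_bigsetU.
move=> cv; rewrite -(cvg_lim _ cv)//.
apply: lime_le; [by apply/cvg_ex; eexists; exact: cv|].
by apply: nearW => n; exact: small.
Qed.

(** The Lebesgue-Stieltjes measure of F is dominated by the Lebesgue measure;
    g is its Radon-Nikodym derivative. *)
Lemma nondecreasing_density : exists2 g : R -> R,
  mu.-integrable setT (EFin \o g) &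
  forall x, a <= x <= b -> F x - F a = \int[mu]_(t in `[a, x]) g t.
Proof.
have [g [g0 gfin gint gE]] := radon_nikodym_sigma_finite nuI_ac.
have gE' : EFin \o (fine \o g) = g by apply/funext => x /=; rewrite fineK.
exists (fine \o g); first by rewrite gE'.
move=> x /andP[ax xb].
rewrite /Rintegral -[X in fine (integral _ _ X)]/(EFin \o (fine \o g)) gE'.
rewrite -integral_itv_obnd_cbnd; last first.
  by apply: (measurable_int mu); apply: (integrableS measurableT) gint.
rewrite -gE; last exact: measurable_itv.
rewrite /nuI/= /mfrestr /mrestr setIidl; last first.
  by apply: subset_itvl; rewrite bnd_simp.
by rewrite nu_oc// /cl_fun !clamp_id ?ax ?xb ?lexx ?(ltW ab).
Qed.

End Monotone.
End Density.

Section FTC.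
Context {R : realType}.
Notation mu := (@lebesgue_measure R).

(** Fundamental theorem of calculus for absolutely continuous functions. With
    V the variation of f from a, both V and V - f are nondecreasing and
    absolutely continuous, hence primitives; Lebesgue's differentiation theorem
    then gives the derivative. *)
Lemma abs_cont_FTC (a b : R) (f : R -> R) : a < b -> abs_cont_on a b f ->
  exists g : R -> R, [/\ mu.-integrable setT (EFin \o g),
    forall x, a <= x <= b -> f x = f a + \int[mu]_(t in `[a, x]) g t &
    {ae mu, forall x, a < x < b -> is_derive x (1:R) f (g x)}].
Proof.
move=> ab fac; have fin := abs_cont_on_BV (ltW ab) fac.
pose V := var_fun a f; have Vac : abs_cont_on a b V := abs_cont_on_var_fun (ltW ab) fac.
have Vnd : {in `[a, b] &, {homo V : x y / x <= y}}.
  move=> x y; rewrite !in_itv/= => /andP[ax xb] /andP[ay yb] xy.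
  by rewrite -subr_ge0 (le_trans _ (var_fun_ge fin ax xy yb)).
pose W x := V x - f x.
have Wac : abs_cont_on a b W.
  apply: abs_cont_on_le2 Vac fac => x y _ _ _.
  have -> : W y - W x = (V y - V x) - (f y - f x) by rewrite /W; ring.
  exact: ler_normB.
have Wnd : {in `[a, b] &, {homo W : x y / x <= y}}.
  move=> x y; rewrite !in_itv/= => /andP[ax xb] /andP[ay yb] xy.
  have := var_fun_ge fin ax xy yb; have := ler_norm (f y - f x).
  by rewrite /W /V; lra.
have [g1 g1int g1E] := nondecreasing_density ab Vnd Vac.
have [g2 g2int g2E] := nondecreasing_density ab Wnd Wac.
have gint : mu.-integrable setT (EFin \o (g1 \- g2)).
  have -> : EFin \o (g1 \- g2) = ((EFin \o g1) \- (EFin \o g2))%E by apply/funext.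
  exact: integrableB.
have fE x : a <= x <= b -> f x = f a + \int[mu]_(t in `[a, x]) (g1 \- g2) t.
  move=> axb; rewrite RintegralB//; try exact: (integrableS measurableT).
  by rewrite -g1E// -g2E// /W; lra.
exists (g1 \- g2); split => //.
have := @FTC1 _ (g1 \- g2) (BLeft a).
have sub y : mu.-integrable [set` Interval (BLeft a) (BRight y)] (EFin \o (g1 \- g2)).
  exact: (integrableS measurableT) gint.
move=> /(_ sub (open_integrable_locally openT gint)).
apply: filterS; first exact: (ae_filter_ringOfSetsType mu).
move=> x /= + /andP[ax xb].
rewrite lte_fin => /(_ ax) [].
set F := (F in derivable F) => dF F'E.
have nearfF : \near x, f x = f a + F x.
  have : x \in `]a, b[ by rewrite in_itv/= ax.
  move=> /near_in_itvoo; apply: filterS => y; rewrite in_itv/= => /andP[ay yb].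
  by apply: fE; rewrite (ltW ay) (ltW yb).
apply: (@near_eq_is_derive _ _ _ (fun y => f a + F y)).
  by apply: filterS nearfF => y ->.
have dF1 : is_derive x (1 : R) F (g1 x - g2 x).
  by apply: DeriveDef => //; rewrite -derive1E F'E.
by rewrite -[X in is_derive _ _ _ X]add0r; exact: is_deriveD.
Qed.

End FTC.

(** * The mass inner product and plane rotations *)

Section MassAlgebra.
Context {R : realType}.
Variables (N d : nat) (m : 'I_N -> R).
Implicit Types (x y v w : 'M[R]_(N, d)) (J theta : 'M[R]_d).

Lemma edot_rows x y i j :
  edot (row i x) (row j y) = (x *m y^T) i j.
Proof. by rewrite mxE /edot; apply: eq_bigr => k _; rewrite !mxE. Qed.

Lemma mass_dotE x y : mass_dot m x y = \sum_i m i * (x *m y^T) i i.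
Proof. by apply: eq_bigr => i _; rewrite edot_rows. Qed.

Lemma mass_dotEs x y : mass_dot m x y = \sum_i m i * \sum_k x i k * y i k.
Proof.
by apply: eq_bigr => i _; congr (_ * _); apply: eq_bigr => k _; rewrite !mxE.
Qed.

Lemma mass_dotC x y : mass_dot m x y = mass_dot m y x.
Proof.
rewrite !mass_dotEs; apply: eq_bigr => i _; congr (_ * _).
by apply: eq_bigr => k _; rewrite mulrC.
Qed.

Lemma mass_dotDl x y z : mass_dot m (x + y) z = mass_dot m x z + mass_dot m y z.
Proof.
rewrite !mass_dotE -big_split/=; apply: eq_bigr => i _.
by rewrite mulmxDl mxE mulrDr.
Qed.

Lemma mass_dotZl a x y : mass_dot m (a *: x) y = a * mass_dot m x y.
Proof.
rewrite !mass_dotE mulr_sumr; apply: eq_bigr => i _.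
by rewrite -scalemxAl mxE mulrCA.
Qed.

Lemma mass_dotDr x y z : mass_dot m z (x + y) = mass_dot m z x + mass_dot m z y.
Proof. by rewrite mass_dotC mass_dotDl !(mass_dotC z). Qed.

Lemma mass_dotZr a x y : mass_dot m x (a *: y) = a * mass_dot m x y.
Proof. by rewrite mass_dotC mass_dotZl mass_dotC. Qed.

Lemma mass_dotNl x y : mass_dot m (- x) y = - mass_dot m x y.
Proof. by rewrite -scaleN1r mass_dotZl mulN1r. Qed.

Lemma mass_dot_rotate theta x y : theta *m theta^T = 1%:M ->
  mass_dot m (rotate theta x) (rotate theta y) = mass_dot m x y.
Proof.
move=> /mulmx1C tt; rewrite !mass_dotE; apply: eq_bigr => i _.
by rewrite /rotate trmx_mul trmxK mulmxA -(mulmxA x) tt mulmx1.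
Qed.

Lemma potential_rotate theta x : theta *m theta^T = 1%:M ->
  potential m (rotate theta x) = potential m x.
Proof.
move=> /mulmx1C tt; apply: eq_bigr => i _; apply: eq_bigr => j _.
congr (_ / _%:E)%E; rewrite /enorm /rotate !row_mul -mulmxBl.
congr (Num.sqrt _).
have E (z : 'rV[R]_d) : edot z z = (z *m z^T) ord0 ord0.
  by rewrite mxE; apply: eq_bigr => k _; rewrite mxE.
by rewrite !E trmx_mul trmxK mulmxA -(mulmxA _ theta^T) tt mulmx1.
Qed.

Hypothesis hm : forall i, 0 < m i.

Lemma mass_dot_ge0 x : 0 <= mass_dot m x x.
Proof.
rewrite mass_dotEs; apply: sumr_ge0 => i _; rewrite mulr_ge0 ?(ltW (hm i))//.
by apply: sumr_ge0 => k _; rewrite -expr2 sqr_ge0.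
Qed.

Lemma mass_norm_sqr x : mass_norm m x ^+ 2 = mass_dot m x x.
Proof. by rewrite /mass_norm sqr_sqrtr// mass_dot_ge0. Qed.

Lemma potential_ge0 x : (0 <= potential m x)%E.
Proof.
apply: sume_ge0 => i _; apply: sume_ge0 => j _.
rewrite mule_ge0//; first by rewrite lee_fin mulr_ge0// ltW.
by rewrite inve_ge0 lee_fin sqrtr_ge0.
Qed.

Lemma lagrangian_ge0 x v : (0 <= lagrangian m x v)%E.
Proof.
by rewrite adde_ge0 ?potential_ge0// lee_fin mulr_ge0// sqr_ge0.
Qed.

End MassAlgebra.

Section PlaneRotation.
Context {R : realType}.
Variables (d : nat).

(** The generator of the rotations of the coordinate plane (k, l). *)
Definition plane_gen (k l : 'I_d) : 'M[R]_d := delta_mx k l - delta_mx l k.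

Lemma plane_gen_tr k l : (plane_gen k l)^T = - plane_gen k l.
Proof. by rewrite /plane_gen linearB/= !trmx_delta opprB. Qed.

(** J ^ 3 = - J is what makes the exponential series of s J sum up to
    plane_rot. *)
Lemma plane_gen_cube k l : k != l ->
  plane_gen k l *m plane_gen k l *m plane_gen k l = - plane_gen k l.
Proof.
move=> kl; have lk : l != k by rewrite eq_sym.
rewrite /plane_gen !(mulmxBl, mulmxBr) !mul_delta_mx_cond !eqxx (negbTE kl) (negbTE lk).
rewrite !mulr0n !mulr1n !(mulmxBl, mulmxBr, mul0mx) !mul_delta_mx_cond !eqxx (negbTE kl) (negbTE lk).
by rewrite !mulr0n !mulr1n; apply/matrixP => i j; rewrite !mxE; ring.
Qed.

Variable J : 'M[R]_d.
Hypothesis Jtr : J^T = - J.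
Hypothesis Jcube : J *m J *m J = - J.

(** The exponential of s J, by Rodrigues' formula. *)
Definition plane_rot (s : R) : 'M[R]_d :=
  1%:M + (sin s *: J + (1 - cos s) *: (J *m J)).

Lemma plane_rotD s t : plane_rot (s + t) = plane_rot s *m plane_rot t.
Proof.
rewrite /plane_rot sinD cosD.
have J3 : J *m (J *m J) = - J by rewrite mulmxA.
have J4 : J *m J *m (J *m J) = - (J *m J) by rewrite -mulmxA J3 mulmxN.
rewrite !(mulmxDl, mulmxDr) !mul1mx !mulmx1.
rewrite -!scalemxAl -!scalemxAr Jcube J3 J4.
by move: (J *m J) => J2; apply/matrixP => i j; rewrite !mxE; ring.
Qed.

Lemma plane_rot0 : plane_rot 0 = 1%:M.
Proof. by rewrite /plane_rot sin0 cos0 subrr !scale0r !addr0. Qed.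

Lemma plane_rot_tr s : (plane_rot s)^T = plane_rot (- s).
Proof.
rewrite /plane_rot sinN cosN !linearD/= !linearZ/= trmx1 trmx_mul Jtr.
by rewrite mulmxN mulNmx opprK scalerN scaleNr.
Qed.

Lemma plane_rot_orth s : plane_rot s *m (plane_rot s)^T = 1%:M.
Proof. by rewrite plane_rot_tr -plane_rotD subrr plane_rot0. Qed.

(** plane_rot s is the square of plane_rot (s / 2), and an orthogonal matrix
    has determinant of square 1. *)
Lemma plane_rot_SO s : SO d (plane_rot s).
Proof.
split; first exact: plane_rot_orth.
rewrite [s]splitr plane_rotD det_mulmx -{2}det_tr -det_mulmx.
by rewrite plane_rot_orth det1.
Qed.

Lemma plane_rot_comm s : J *m plane_rot s = plane_rot s *m J.
Proof.
by rewrite /plane_rot !(mulmxDl, mulmxDr) mul1mx mulmx1 -!scalemxAl -!scalemxAr mulmxA.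
Qed.

End PlaneRotation.

Lemma rotateM (R : realType) N d (th1 th2 : 'M[R]_d) (x : 'M[R]_(N, d)) :
  rotate (th1 *m th2) x = rotate th1 (rotate th2 x).
Proof. by rewrite /rotate trmx_mul mulmxA. Qed.

Lemma rotate1 (R : realType) N d (x : 'M[R]_(N, d)) : rotate 1%:M x = x.
Proof. by rewrite /rotate trmx1 mulmx1. Qed.

(** Noether: a component of the angular momentum is, up to sign, the velocity
    paired with the infinitesimal rotation of the corresponding plane. *)
Lemma angular_momentum_gen (R : realType) N d (m : 'I_N -> R) k l
    (x v : 'M[R]_(N, d)) :
  angular_momentum m x v k l = - mass_dot m (rotate (plane_gen k l) x) v.
Proof.
rewrite mass_dotE /angular_momentum summxE -sumrN; apply: eq_bigr => i _.
rewrite /rotate plane_gen_tr mulmxN mulNmx !mxE mulrN opprK; congr (_ * _).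
rewrite !big_ord1 !mxE.
have xJ b : (x *m plane_gen k l) i b = x i k *+ (l == b) - x i l *+ (k == b).
  rewrite mulmxBr !mxE; congr (_ - _).
    rewrite (bigD1 k)//= mxE eqxx/= big1 ?addr0.
      by rewrite mulr_natr eq_sym.
    by move=> j jk; rewrite mxE (negbTE jk) mulr0.
  rewrite (bigD1 l)//= mxE eqxx/= big1 ?addr0.
    by rewrite mulr_natr eq_sym.
  by move=> j jk; rewrite mxE (negbTE jk) mulr0.
under eq_bigr => b _ do rewrite xJ mulrBl !mxE.
rewrite sumrB; congr (_ - _).
  rewrite (bigD1 l)//= eqxx mulr1n big1 ?addr0// => b bl.
  by rewrite eq_sym (negbTE bl) mulr0n mul0r.
rewrite (bigD1 k)//= eqxx mulr1n big1 ?addr0; first by rewrite mulrC.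
by move=> b bl; rewrite eq_sym (negbTE bl) mulr0n mul0r.
Qed.

(** * Curves in configuration space and turning frames *)

Section MatrixCurves.
Context {R : realType}.
Variables (N d : nat).
Implicit Types (gamma : R -> 'M[R]_(N, d)).

Lemma le_entry_mx_norm p q (A : 'M[R]_(p, q)) i j : `|A i j| <= `|A|.
Proof.
rewrite [leRHS]/Num.Def.normr/= mx_normrE.
exact: (le_bigmax _ (fun ij => `|A ij.1 ij.2|) (i, j)).
Qed.

Lemma abs_cont_on_entry p q a b (A : R -> 'M[R]_(p, q)) i j :
  abs_cont_on a b A -> abs_cont_on a b (fun t => A t i j).
Proof.
apply: (abs_cont_on_dom (C := 1)) => x y _ _ _.
by rewrite mul1r (le_trans _ (le_entry_mx_norm _ i j))// !mxE.
Qed.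

Lemma abs_cont_on_mx p q a b (A : R -> 'M[R]_(p, q)) :
  (forall i j, abs_cont_on a b (fun t => A t i j)) -> abs_cont_on a b A.
Proof.
move=> H.
have -> : A = fun t => \sum_i \sum_j A t i j *: delta_mx i j.
  by apply/funext => t; exact: matrix_sum_delta.
apply: abs_cont_on_sum => i _; apply: abs_cont_on_sum => j _.
apply: (abs_cont_on_dom (C := `|delta_mx i j : 'M[R]_(p, q)|)) (H i j).
by move=> x y _ _ _; rewrite -scalerBl normrZ mulrC.
Qed.

Lemma abs_cont_on_mulmx p q r a b (A : R -> 'M[R]_(p, q)) (B : R -> 'M[R]_(q, r)) :
  a <= b -> abs_cont_on a b A -> abs_cont_on a b B ->
  abs_cont_on a b (fun t => A t *m B t).
Proof.
move=> ab Aac Bac; apply: abs_cont_on_mx => i j.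
under [X in abs_cont_on _ _ X]eq_fun do rewrite mxE.
apply: (@abs_cont_on_sum _ _ _ _ _ a b (fun k t => A t i k * B t k j)) => k _.
by apply: abs_cont_onM => //; exact: abs_cont_on_entry.
Qed.

Lemma is_derive_mxP p q (A : R -> 'M[R]_(p, q)) (t : R) (D : 'M[R]_(p, q)) :
  is_derive t 1 A D <-> forall i j, is_derive t 1 (fun s => A s i j) (D i j).
Proof.
split=> [[dA DA] i j|H].
  apply: DeriveDef; first exact: (derivable_mxP A t 1).1 dA i j.
  by have := derive_mx dA; rewrite DA => ->; rewrite mxE.
have dA : derivable A t 1 by apply/derivable_mxP => i j; have [] := H i j.
apply: DeriveDef => //; rewrite derive_mx//; apply/matrixP => i j.
by rewrite mxE; have [] := H i j.
Qed.

Lemma is_derive_mulmx p q r (A : R -> 'M[R]_(p, q)) (B : R -> 'M[R]_(q, r))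
    (t : R) DA DB :
  is_derive t 1 A DA -> is_derive t 1 B DB ->
  is_derive t 1 (fun s => A s *m B s) (DA *m B t + A t *m DB).
Proof.
move=> /is_derive_mxP dA /is_derive_mxP dB; apply/is_derive_mxP => i j.
have -> : (fun s => (A s *m B s) i j) = \sum_k (fun s => A s i k * B s k j).
  by apply/funext => s; rewrite mxE fct_sumE.
have -> : (DA *m B t + A t *m DB) i j =
    \sum_k (A t i k *: DB k j + B t k j *: DA i k).
  rewrite !mxE -big_split/=; apply: eq_bigr => k _.
  by rewrite addrC /GRing.scale/= (mulrC (B t k j)).
by apply: is_derive_sum => k; apply: is_deriveM.
Qed.

Lemma norm_sin_sub (x y : R) : `|sin y - sin x| <= `|y - x|.
Proof.
wlog xy : x y / x < y.
  move=> H; have [->|] := eqVneq x y; first by rewrite !subrr normr0.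
  by rewrite neq_lt => /orP[/H//|/H]; rewrite distrC (distrC x).
have [|c _ ->] := @MVT _ (@sin R) (@cos R) x y xy.
  by apply: continuous_subspaceT => z; exact: continuous_sin.
by rewrite normrM ler_piMl// ler_norml cos_geN1 cos_le1.
Qed.

Lemma norm_cos_sub (x y : R) : `|cos y - cos x| <= `|y - x|.
Proof.
wlog xy : x y / x < y.
  move=> H; have [->|] := eqVneq x y; first by rewrite !subrr normr0.
  by rewrite neq_lt => /orP[/H//|/H]; rewrite distrC (distrC x).
have [|c _ ->] := @MVT _ (@cos R) (fun x => - sin x) x y xy.
  by apply: continuous_subspaceT => z; exact: continuous_cos.
by rewrite normrM normrN ler_piMl// ler_norml sin_geN1 sin_le1.
Qed.

Variable J : 'M[R]_d.
Hypothesis Jtr : J^T = - J.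
Hypothesis Jcube : J *m J *m J = - J.

Lemma abs_cont_on_plane_rot a b al be : a <= b ->
  abs_cont_on a b (fun t => plane_rot J (al + be * t)).
Proof.
move=> ab; have lin x y : al + be * y - (al + be * x) = be * (y - x) by ring.
apply: abs_cont_onD; first exact: abs_cont_on_cst.
apply: abs_cont_onD.
  apply: (abs_cont_on_dom (C := `|be| * `|J|)) (abs_cont_on_id a b) => x y _ _ _.
  rewrite -scalerBl normrZ mulrAC ler_wpM2r// (le_trans (norm_sin_sub _ _))//.
  by rewrite lin normrM.
apply: (abs_cont_on_dom (C := `|be| * `|J *m J|)) (abs_cont_on_id a b) => x y _ _ _.
rewrite -scalerBl normrZ mulrAC ler_wpM2r//.
rewrite (_ : _ - _ = cos (al + be * x) - cos (al + be * y)); last by ring.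
by rewrite distrC (le_trans (norm_cos_sub _ _))// lin normrM.
Qed.

Lemma is_derive_plane_rot al be (t : R) :
  is_derive t 1 (fun t => plane_rot J (al + be * t))
    (be *: (J *m plane_rot J (al + be * t))).
Proof.
apply/is_derive_mxP => i j.
set th := al + be * t.
have J3 : J *m (J *m J) = - J by rewrite mulmxA.
have -> : (fun s => plane_rot J (al + be * s) i j) =
   (fun s => (1%:M : 'M[R]_d) i j + (sin (al + be * s) * J i j +
      (1 - cos (al + be * s)) * (J *m J) i j)).
  by apply/funext => s; rewrite /plane_rot !mxE.
have dth : is_derive t (1 : R) (fun s => al + be * s) be.
  rewrite -[X in is_derive _ _ _ X]add0r; apply: is_deriveD.
  rewrite -[X in is_derive _ _ _ X]mulr1.
  by have := @is_deriveZ _ _ _ (@idfun R) be t 1 1 (is_derive_id t 1).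
have dsin : is_derive t (1 : R) (fun s => sin (al + be * s)) (cos th * be).
  exact: (@is_derive1_comp _ (@sin R) (fun s => al + be * s)).
have dcos : is_derive t (1 : R) (fun s => cos (al + be * s)) (- sin th * be).
  exact: (@is_derive1_comp _ (@cos R) (fun s => al + be * s)).
have dJ := is_deriveM dsin (is_derive_cst (J i j) t 1).
have dJJ := is_deriveM (is_deriveB (is_derive_cst (1 : R) t 1) dcos)
  (is_derive_cst ((J *m J) i j) t 1).
have dsum := is_deriveD (is_derive_cst ((1%:M : 'M[R]_d) i j) t 1) (is_deriveD dJ dJJ).
suff <- : 0 + (sin th *: 0 + cst (J i j) t *: (cos th * be) + ((1 - cos th) *: 0 +
    cst ((J *m J) i j) t *: (0 - (- sin th * be)))) =
    (be *: (J *m plane_rot J th)) i j by exact: dsum.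
rewrite /plane_rot !mulmxDr mulmx1 -!scalemxAr J3.
rewrite /GRing.scale/= -/th.
move: (J *m J) => J2; rewrite !mxE; ring.
Qed.

(** gamma seen from a frame that starts at angle al and turns in the plane of
    J with angular velocity be. *)
Definition turning al be gamma (t : R) := rotate (plane_rot J (al + be * t)) (gamma t).

Lemma abs_cont_on_turning a b al be gamma : a <= b ->
  abs_cont_on a b gamma -> abs_cont_on a b (turning al be gamma).
Proof.
move=> ab gac; apply: abs_cont_on_mulmx => //.
have := abs_cont_on_plane_rot al be ab.
move=> Pac; apply: abs_cont_on_mx => i j.
under [X in abs_cont_on _ _ X]eq_fun do rewrite mxE.
exact: (abs_cont_on_entry j i Pac).
Qed.

(** J commutes with its exponential, so the angular velocity can be moved
    inside the rotation, where invariance will remove the latter. *)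
Lemma is_derive_turning al be gamma (t : R) D : is_derive t 1 gamma D ->
  is_derive t 1 (turning al be gamma)
    (rotate (plane_rot J (al + be * t)) (D + be *: rotate J (gamma t))).
Proof.
move=> dg.
have dP : is_derive t 1 (fun s => (plane_rot J (al + be * s))^T)
    ((be *: (J *m plane_rot J (al + be * t)))^T).
  apply/is_derive_mxP => i j; rewrite mxE.
  under [X in is_derive _ _ X _]eq_fun do rewrite mxE.
  by have /is_derive_mxP := is_derive_plane_rot al be t; exact.
apply: is_derive_eq (is_derive_mulmx dg dP) _.
rewrite /rotate linearZ/= plane_rot_comm trmx_mul mulmxDl; congr (_ + _).
by rewrite -scalemxAr -scalemxAl mulmxA.
Qed.

End MatrixCurves.

(** * Almost everywhere statements and measurability *)

Section LowerIntegral.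
Context {d : measure_display} {T : measurableType d} {R : realType}.
Variable mu : {measure set T -> \bar R}.
Import HBNNSimple.

(** The integral of a nonnegative function is a supremum over the simple
    functions below it; multiplied by the indicator of a conull set, a simple
    function below f is below g. So the comparison extends to nonmeasurable f and
    g, such as a Lagrangian containing derive1. *)
Lemma ge0_ae_le_integral (D : set T) (f g : T -> \bar R) :
  (forall x, D x -> (0 <= f x)%E) -> (forall x, D x -> (0 <= g x)%E) ->
  {ae mu, forall x, D x -> (f x <= g x)%E} ->
  (\int[mu]_(x in D) f x <= \int[mu]_(x in D) g x)%E.
Proof.
move=> f0 g0 [M [mM M0 fgM]]; rewrite !ge0_integralE//.
apply: ge_ereal_sup => _ [h hf <-].
have mC : measurable (~` M) by exact: measurableC.
pose h' := mul_nnsfun h (indic_nnsfun R mC).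
rewrite -integralT_nnsfun (_ : (\int[mu]_x (h x)%:E)%E = (\int[mu]_x (h' x)%:E)%E).
  rewrite integralT_nnsfun; apply: ereal_sup_ubound; exists h' => // x.
  rewrite /h' /= /measurable_realfun.mindic indicE; have [xM|xM] := boolP (x \in M).
    rewrite (_ : (x \in ~` M) = false) ?mulr0; last first.
      by rewrite in_setC xM.
    by rewrite /patch; case: ifPn => // /set_mem/g0.
  rewrite (_ : (x \in ~` M) = true) ?mulr1; last by rewrite in_setC xM.
  have := hf x; rewrite /patch; case: ifPn => // /set_mem Dx hfx.
  apply: (le_trans hfx); apply: contrapT => fg.
  by move: xM => /negP; apply; apply/mem_set/fgM => /(_ Dx).
apply: ge0_ae_eq_integral => //.
- by apply/measurable_EFinP; exact: measurable_funTS.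
- by apply/measurable_EFinP; exact: measurable_funTS.
- by move=> x _; rewrite lee_fin.
- by move=> x _; rewrite lee_fin.
- exists M; split => // x /=; apply: contra_notP => xM _.
  by rewrite /h' /= /measurable_realfun.mindic indicE mem_set ?mulr1.
Qed.

Lemma ge0_ae_eq_integral_lower (D : set T) (f g : T -> \bar R) :
  (forall x, D x -> (0 <= f x)%E) -> (forall x, D x -> (0 <= g x)%E) ->
  {ae mu, forall x, D x -> f x = g x} ->
  (\int[mu]_(x in D) f x = \int[mu]_(x in D) g x)%E.
Proof.
move=> f0 g0 [M [mM M0 fgM]]; apply/eqP; rewrite eq_le; apply/andP; split;
  apply: ge0_ae_le_integral => //; exists M; split => // x nle; apply: fgM => eqx;
  by apply: nle => Dx; rewrite eqx.
Qed.

End LowerIntegral.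

Section AlmostEverywhere.
Context {R : realType}.
Notation mu := (@lebesgue_measure R).

Lemma ae_itv_cc (a b : R) (P : R -> Prop) :
  {ae mu, forall x, a < x < b -> P x} ->
  {ae mu, forall x, x \in `[a, b] -> P x}.
Proof.
move=> [M [mM M0 PM]]; exists (M `|` ([set a] `|` [set b])); split.
- by apply: measurableU => //; apply: measurableU.
- have ab0 : mu ([set a] `|` [set b]) = 0%E.
    by rewrite measureU0//; exact: lebesgue_measure_set1.
  by rewrite measureU0 ?ab0//; exact: measurableU.
- move=> x /=; have [->|xa] := eqVneq x a; first by right; left.
  have [->|xb] := eqVneq x b; first by right; right.
  move=> nP; left; apply: PM => /= Px; apply: nP; rewrite in_itv/= => /andP[ax xb'].
  by apply: Px; rewrite !lt_neqAle ax xb' xb eq_sym xa.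
Qed.

Lemma ae_opp (P : R -> Prop) : {ae mu, forall x, P x} ->
  {ae mu, forall x, P (- x)}.
Proof.
move=> [M [mM M0 PM]]; exists ((-%R : measurableTypeR R -> measurableTypeR R) @^-1` M); split.
- have mopp : measurable_fun setT (-%R : measurableTypeR R -> measurableTypeR R) by [].
  by rewrite -[X in measurable X]setTI; exact: mopp.
- by rewrite -[LHS](lebesgue_measureN mM) in M0 *.
- by move=> x /= nP; apply: PM.
Qed.

Lemma ae_itv_exists (a b : R) (P : R -> Prop) : a < b ->
  {ae mu, forall x, x \in `[a, b] -> P x} -> exists2 x, a < x < b & P x.
Proof.
move=> ab [M [mM M0 PM]]; apply: contrapT => nex.
have sub : `]a, b[ `<=` M.
  move=> x /=; rewrite in_itv/= => axb; apply: PM => /= Px; apply: nex; exists x => //.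
  by apply: Px; rewrite in_itv/=; case/andP: axb => /ltW -> /ltW ->.
have : (mu `]a, b[ <= mu M)%E by apply: le_measure => //; rewrite inE.
rewrite M0 lebesgue_measure_itv/= lte_fin ab -EFinB lee_fin.
by rewrite leNgt subr_gt0 ab.
Qed.

Lemma ge0_integral_itv_opp (T : R) (F : R -> \bar R) :
  measurable_fun `[0, T] F -> (forall x, (0 <= F x)%E) ->
  (\int[mu]_(x in `[(- T)%R, 0%R]) F (- x)%R = \int[mu]_(x in `[0%R, T]) F x)%E.
Proof.
move=> mF F0.
rewrite (_ : `[(- T)%R, 0%R]%classic =
    (-%R : _ -> measurableTypeR R) @^-1` `[0%R, T]); last first.
  by rewrite opp_preimage_itvbndbnd oppr0.
rewrite -ge0_integral_pushforward//=.
by apply: eq_measure_integral => //= A mA AS; exact: lebesgue_measureN.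
Qed.

Lemma measurable_abs_cont (a b : R) (f : R -> R) : a <= b ->
  abs_cont_on a b f -> measurable_fun `[a, b] f.
Proof.
move=> ab fac; apply: (eq_measurable_fun (f \o clamp a b)).
  by move=> x /[!inE] /=; rewrite in_itv/= => axb; rewrite clamp_id.
apply: measurable_funTS; apply: continuous_measurable_fun.
exact: (clamp_continuous ab fac).
Qed.

Lemma measurable_inve : measurable_fun [set: R] (fun r : R => (r%:E)^-1%E).
Proof.
rewrite (_ : (fun r : R => _) =
    (fun r : R => if r == 0 then +oo%E else (r^-1)%:E)); last first.
  by apply/funext => r; rewrite inver.
have E : (setT `&` (fun r : R => r == 0) @^-1` [set false]) = ~` [set 0 : R].
  by apply/seteqP; split=> r /=; [move=> [_ /negbT/eqP]|move=> /eqP/negbTE].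
apply: measurable_fun_if => //.
- apply: (measurable_fun_bool true) => /=.
  rewrite (_ : _ `&` _ = [set 0]) //.
  apply/seteqP; split=> r /=; first by move=> [_ /eqP].
  by move=> ->; rewrite eqxx.
- rewrite E; apply/measurable_EFinP; apply: open_continuous_measurable_fun.
    by apply: closed_openC; exact: closed_eq.
  by move=> r /[!inE] /= /eqP r0; exact: inv_continuous.
Qed.

End AlmostEverywhere.

Section Measurability.
Context {R : realType}.
Variables (N d : nat) (m : 'I_N -> R).
Notation mu := (@lebesgue_measure R).
Implicit Types (gamma G : R -> 'M[R]_(N, d)).

Lemma measurable_enorm (D : set R) (r : R -> 'rV[R]_d) : measurable D ->
  (forall k, measurable_fun D (fun t => r t ord0 k)) ->
  measurable_fun D (fun t => enorm (r t)).
Proof.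
move=> mD mr; rewrite /enorm.
apply: (measurableT_comp (f := @Num.sqrt R)).
  by apply: continuous_measurable_fun; exact: sqrt_continuous.
apply: measurable_sum => k; exact: measurable_funM.
Qed.

Lemma measurable_potential (D : set R) gamma : measurable D ->
  (forall i k, measurable_fun D (fun t => gamma t i k)) ->
  measurable_fun D (fun t => potential m (gamma t)).
Proof.
move=> mD mg; rewrite /potential.
apply: emeasurable_sum => i.
under eq_fun do rewrite big_mkcond/=.
apply: emeasurable_sum => j; case: (i < j)%N; last exact: measurable_cst.
apply: emeasurable_funM => //.
apply: (measurableT_comp measurable_inve).
apply: measurable_enorm => // k.
under eq_fun do rewrite !mxE.
exact: measurable_funB.
Qed.

Lemma measurable_mass_dot (D : set R) (X Y : R -> 'M[R]_(N, d)) : measurable D ->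
  (forall i k, measurable_fun D (fun t => X t i k)) ->
  (forall i k, measurable_fun D (fun t => Y t i k)) ->
  measurable_fun D (fun t => mass_dot m (X t) (Y t)).
Proof.
move=> mD mX mY; under eq_fun do rewrite mass_dotEs.
apply: measurable_sum => i; apply: measurable_funM => //.
apply: measurable_sum => k; exact: measurable_funM.
Qed.

(** derive1 gamma is only known to agree almost everywhere with a Borel
    function; the integrals below are taken of such a G, entrywise integrable,
    of which gamma is the primitive. *)
Definition velocity_on T gamma G :=
  [/\ forall i k, mu.-integrable setT (fun t => (G t i k)%:E),
      forall x i k, 0 <= x <= T ->
        gamma x i k = gamma 0 i k + \int[mu]_(t in `[0, x]) G t i k &
      {ae mu, forall x, x \in `[0, T] -> is_derive x (1 : R) gamma (G x)}].
End Measurability.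

(** * Domination along turned curves *)

Section Action.
Context {R : realType}.
Variables (N d : nat) (m : 'I_N -> R).
Hypothesis hm : forall i : 'I_N, 0 < m i.
Notation mu := (@lebesgue_measure R).
Implicit Types (gamma G : R -> 'M[R]_(N, d)) (T : R).

Lemma velocity_exists T gamma : 0 < T -> abs_cont_on 0 T gamma ->
  exists G, velocity_on T gamma G.
Proof.
move=> T0 gac.
have /choice[g gP] : forall ik : 'I_N * 'I_d, exists g : R -> R,
    [/\ mu.-integrable setT (EFin \o g),
    forall x, 0 <= x <= T ->
      gamma x ik.1 ik.2 = gamma 0 ik.1 ik.2 + \int[mu]_(t in `[0, x]) g t &
    {ae mu, forall x, 0 < x < T ->
      is_derive x (1:R) (fun s => gamma s ik.1 ik.2) (g x)}].
  by move=> [i k]; apply: (abs_cont_FTC T0); exact: (abs_cont_on_entry i k gac).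
exists (fun t => \matrix_(i, k) g (i, k) t); split.
- move=> i k; have [+ _ _] := gP (i, k).
  by under [X in _ -> _.-integrable _ X]eq_fun do rewrite mxE.
- move=> x i k xT; have [_ -> // _] := gP (i, k).
  by congr (_ + _); apply: eq_Rintegral => t _; rewrite mxE.
- apply: ae_itv_cc.
  have : {ae mu, forall x, forall ik, 0 < x < T ->
      is_derive x (1:R) (fun s => gamma s ik.1 ik.2) (g ik x)}.
    apply: (@filter_forall _ _ (fun ik x => 0 < x < T ->
      is_derive x (1:R) (fun s => gamma s ik.1 ik.2) (g ik x)) _
      (ae_filter_ringOfSetsType mu)).
    by move=> ik; have [] := gP ik.
  apply: filterS; first exact: (ae_filter_ringOfSetsType mu).
  move=> x H xT; apply/is_derive_mxP => i k; rewrite mxE; exact: (H (i, k)).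
Qed.

Lemma velocity_on_sub T T' gamma G : T' <= T ->
  velocity_on T gamma G -> velocity_on T' gamma G.
Proof.
move=> TT [Gint GE Gd]; split => //.
- by move=> x i k /andP[x0 xT]; apply: GE; rewrite x0 (le_trans xT).
- move: Gd; apply: filterS; first exact: (ae_filter_ringOfSetsType mu).
  move=> x H; rewrite in_itv/= => /andP[x0 xT]; apply: H.
  by rewrite in_itv/= x0 (le_trans xT).
Qed.

Lemma measurable_velocity T gamma G (D : set R) i k : velocity_on T gamma G ->
  measurable_fun D (fun t => G t i k).
Proof.
move=> [Gint _ _]; apply: measurable_funTS; apply/measurable_EFinP.
by have /integrableP[] := Gint i k.
Qed.

Variable J : 'M[R]_d.

(** The Lagrangian along turning J al be gamma, expressed along gamma: the
    rotation itself drops out by invariance, only its angular velocity be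
    remains. For be = 0 it is the Lagrangian of gamma. *)
Definition turning_lagrangian be gamma G t : \bar R :=
  ((2^-1 * mass_dot m (G t + be *: rotate J (gamma t))
                      (G t + be *: rotate J (gamma t)))%:E +
   potential m (gamma t))%E.

Lemma turning_lagrangian_ge0 be gamma G t :
  (0 <= turning_lagrangian be gamma G t)%E.
Proof.
rewrite adde_ge0 ?potential_ge0// lee_fin mulr_ge0// mass_dot_ge0//.
Qed.

Lemma measurable_curve T gamma i k : 0 <= T -> abs_cont_on 0 T gamma ->
  measurable_fun `[0, T] (fun t => gamma t i k).
Proof.
move=> T0 gac; apply: measurable_abs_cont => //; exact: (abs_cont_on_entry i k gac).
Qed.

Lemma measurable_rotate (D : set R) theta gamma i k :
  (forall i k, measurable_fun D (fun t => gamma t i k)) ->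
  measurable_fun D (fun t => rotate theta (gamma t) i k).
Proof.
move=> mg; rewrite /rotate; under eq_fun do rewrite mxE.
by apply: measurable_sum => l; apply: measurable_funM.
Qed.

Lemma measurable_turning_lagrangian be T gamma G : 0 <= T ->
  abs_cont_on 0 T gamma -> velocity_on T gamma G ->
  measurable_fun `[0, T] (turning_lagrangian be gamma G).
Proof.
move=> T0 gac Gvel.
have mg i k := measurable_curve i k T0 gac.
have mX i k : measurable_fun `[0, T] (fun t => (G t + be *: rotate J (gamma t)) i k).
  rewrite (_ : (fun t => _) = fun t => G t i k + be * rotate J (gamma t) i k).
    2: by apply/funext => t; rewrite !mxE.
  apply: measurable_funD; first exact: measurable_velocity Gvel.
  by apply: measurable_funM => //; exact: measurable_rotate.
apply: emeasurable_funD; last exact: measurable_potential.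
by apply/measurable_EFinP; apply: measurable_funM => //; exact: measurable_mass_dot.
Qed.

Lemma action_turning_lagrangian T gamma G : velocity_on T gamma G ->
  action m 0 T gamma = (\int[mu]_(t in `[0%R, T]) turning_lagrangian 0 gamma G t)%E.
Proof.
move=> [_ _ Gd]; apply: ge0_ae_eq_integral_lower.
- by move=> t _; exact: lagrangian_ge0.
- by move=> t _; exact: turning_lagrangian_ge0.
- move: Gd; apply: filterS; first exact: (ae_filter_ringOfSetsType mu).
  move=> t H tT; have [_ dG] := H tT.
  rewrite /lagrangian /turning_lagrangian mass_norm_sqr// derive1E dG.
  by rewrite scale0r addr0.
Qed.

Lemma abs_cont_on_opp (V : normedModType R) T (f : R -> V) :
  abs_cont_on 0 T f -> abs_cont_on (- T) 0 (fun t => f (- t)).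
Proof.
move=> fac e e0; have [de de0 H] := fac e e0; exists de => // s al pw len.
pose s' := [seq (- p.2, - p.1) | p <- s].
rewrite (_ : \sum_(p <- s) _ = \sum_(q <- s') `|f q.2 - f q.1|); last first.
  by rewrite big_map; apply: eq_bigr => p _; rewrite distrC.
apply: H.
- rewrite all_map; apply: sub_all al => p /and3P[p1 p2 p3] /=.
  by rewrite oppr_ge0 p3 ltrN2 p2 lerNl p1.
- rewrite pairwise_map; apply: sub_pairwise pw => p q /=.
  by rewrite !lerN2 orbC.
- by rewrite big_map; under eq_bigr do rewrite /= opprK addrC.
Qed.

Hypothesis Jtr : J^T = - J.
Hypothesis Jcube : J *m J *m J = - J.
Variable u : 'M[R]_(N, d) -> R.
Hypothesis udom : dominated m u.

(** The comparison behind both directions. Domination bounds u at the end minus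
    u at the start of a curve, whereas calibration reads the curve from start to
    end: domination is applied to the turned curve run backwards, which has the
    same action. *)
Lemma dominated_turning al be T gamma G : 0 < T -> abs_cont_on 0 T gamma ->
  velocity_on T gamma G ->
  ((u (rotate (plane_rot J al) (gamma 0)) -
    u (rotate (plane_rot J (al + be * T)) (gamma T)))%:E <=
   \int[mu]_(t in `[0%R, T]) turning_lagrangian be gamma G t)%E.
Proof.
move=> T0 gac Gvel; have [_ _ Gd] := Gvel.
pose eta t := turning J al be gamma (- t).
have eta_ac : abs_cont_on (- T) 0 eta.
  by apply: abs_cont_on_opp; apply: abs_cont_on_turning => //; exact: ltW.
apply: le_trans (udom _ _) _.
apply: (@le_trans _ _ (action m (- T) 0 eta)).
  apply: ereal_inf_lbound; exists (- T), 0, eta; split => //.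
  - by rewrite oppr_lt0.
  - by rewrite /eta /turning opprK.
  - by rewrite /eta /turning oppr0 mulr0 addr0.
rewrite -ge0_integral_itv_opp; last 2 first.
- by apply: measurable_turning_lagrangian => //; exact: ltW.
- by move=> t; exact: turning_lagrangian_ge0.
apply: ge0_ae_le_integral.
- by move=> t _; exact: lagrangian_ge0.
- by move=> t _; exact: turning_lagrangian_ge0.
move: (ae_opp Gd); apply: filterS; first exact: (ae_filter_ringOfSetsType mu).
move=> t H; rewrite /= in_itv/= => /andP[tT t0].
have {}H : is_derive (- t) 1 gamma (G (- t)).
  by apply: H; rewrite in_itv/= oppr_ge0 t0 lerNl tT.
have dturn := is_derive_turning Jcube al be H.
have deta : is_derive t (1 : R) eta (- (rotate (plane_rot J (al + be * - t))
    (G (- t) + be *: rotate J (gamma (- t))))).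
  apply/is_derive_mxP => i k; rewrite mxE.
  have dopp : is_derive t (1 : R) (-%R : R -> R) (-1).
    exact: is_deriveN.
  have := @is_derive1_comp _ (fun s => turning J al be gamma s i k) (-%R : R -> R) t
    _ _ ((is_derive_mxP _ _ _).1 dturn i k) dopp.
  by rewrite mulrN1.
have [_ dE] := deta.
rewrite /lagrangian derive1E dE mass_norm_sqr// -scaleN1r mass_dotZl mass_dotZr.
rewrite mulN1r mulN1r opprK mass_dot_rotate; last exact: plane_rot_orth.
rewrite /eta /turning potential_rotate//; exact: plane_rot_orth.
Qed.

End Action.

(** * From zero angular momentum to invariance under plane rotations *)

Section Superdiff.
Context {R : realType}.
Notation mu := (@lebesgue_measure R).

Lemma superdiff_derive0 (g : R -> R) (x K D : R) :
  (forall s, g (x + s) - g x <= K * s ^+ 2) -> is_derive x (1:R) g D -> D = 0.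
Proof.
move=> gK [dg gD]; apply/eqP/negPn/negP => D0.
have D20 : 0 < `|D| / 2 by rewrite divr_gt0// normr_gt0.
have := dg; rewrite /derivable => /cvgrPdist_lt.
rewrite -/(derive g x 1) gD => /(_ _ D20)[e /= e0 H].
have K0 : 0 < `|K| + 1 by rewrite ltr_pwDr.
(* h is so short that the parabola adds at most |D| / 2 to the slope *)
pose h := Num.min (e / 2) (`|D| / 2 / (`|K| + 1)).
have h0 : 0 < h by rewrite lt_min !divr_gt0// normr_gt0.
have he : h < e by rewrite gt_min ltr_pdivrMr// ltr_pMr// ltr1n.
have hK : K * h <= `|D| / 2.
  have : h <= `|D| / 2 / (`|K| + 1) by rewrite ge_min lexx orbT.
  rewrite ler_pdivlMr// mulrDr mulr1 => h1.
  rewrite (le_trans _ h1)// mulrC (le_trans (y := h * `|K|))//.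
    by rewrite ler_wpM2l ?ler_norm// ltW.
  by rewrite lerDl ltW.
have key s : s != 0 -> `|s| < e -> `|D - s^-1 * (g (x + s) - g x)| < `|D| / 2.
  move=> s0 se; have := H s; rewrite /ball_/= sub0r normrN => /(_ se s0).
  by rewrite /GRing.scale/= mulr1 (addrC s).
have up s : `|s| = h -> h^-1 * (g (x + s) - g x) <= K * h.
  move=> sh; rewrite ler_pdivrMl// (le_trans (gK s))//.
  by rewrite -real_normK ?num_real// sh expr2 mulrCA.
case: (ltgtP D 0) D0 => // D0 _.
  have := key (- h); rewrite oppr_eq0 gt_eqF// normrN gtr0_norm// => /(_ isT he).
  have := up (- h); rewrite normrN gtr0_norm// => /(_ erefl).
  rewrite ltr0_norm// in hK *; rewrite invrN mulNr opprK.
  by rewrite ltr_norml => ? /andP[? ?]; lra.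
have := key h; rewrite gt_eqF// gtr0_norm// => /(_ isT he).
have := up h; rewrite gtr0_norm// => /(_ erefl).
rewrite gtr0_norm// in hK *.
by rewrite ltr_norml => ? /andP[? ?]; lra.
Qed.

(** The parabola above the graph touches it at x, which forces the derivative
    to vanish wherever it exists, that is almost everywhere. *)
Lemma lipschitz_superdiff_const (g : R -> R) (L b : R) : 0 < b ->
  (forall x y, x < y -> `|g y - g x| <= L * (y - x)) ->
  (forall x, exists K, forall s, g (x + s) - g x <= K * s ^+ 2) ->
  g b = g 0.
Proof.
move=> b0 gL gK.
have gac : abs_cont_on 0 b g.
  by apply: (abs_cont_on_lip (C := L)) => x y _ xy _; exact: gL.
have [h [hint hE hd]] := abs_cont_FTC b0 gac.
rewrite (hE b) ?lexx ?ltW// [X in _ + X](_ : _ = 0) ?addr0//.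
rewrite /Rintegral.
rewrite (@ae_eq_integral _ _ _ mu _ (cst 0%E) _)//.
- by rewrite integral0.
- by apply: measurable_funTS; case/integrableP : hint.
- have := ae_itv_cc hd; apply: filterS; first exact: (ae_filter_ringOfSetsType mu).
  move=> x H xb; have [K xK] := gK x.
  by rewrite (superdiff_derive0 xK (H xb)).
Qed.

End Superdiff.

Section Invariance.
Context {R : realType}.
Variables (N d : nat) (m : 'I_N -> R).
Hypothesis hm : forall i : 'I_N, 0 < m i.
Notation mu := (@lebesgue_measure R).
Implicit Types (gamma G : R -> 'M[R]_(N, d)) (T : R).

Lemma abs_cont_on_mass_dot a b (X Y : R -> 'M[R]_(N, d)) : a <= b ->
  abs_cont_on a b X -> abs_cont_on a b Y ->
  abs_cont_on a b (fun t => mass_dot m (X t) (Y t)).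
Proof.
move=> ab Xac Yac.
under [X in abs_cont_on _ _ X]eq_fun do rewrite mass_dotEs.
apply: (@abs_cont_on_sum _ _ _ _ _ a b
  (fun i t => m i * \sum_k X t i k * Y t i k)) => i _.
apply: abs_cont_onM => //; first exact: abs_cont_on_cst.
apply: (@abs_cont_on_sum _ _ _ _ _ a b (fun k t => X t i k * Y t i k)) => k _.
by apply: abs_cont_onM => //; exact: abs_cont_on_entry.
Qed.

Lemma abs_cont_on_rotate a b theta gamma : a <= b -> abs_cont_on a b gamma ->
  abs_cont_on a b (fun t => rotate theta (gamma t)).
Proof.
move=> ab gac; apply: abs_cont_on_mulmx => //; exact: abs_cont_on_cst.
Qed.

Lemma integral_cst_itv (T c : R) : 0 <= T ->
  (\int[mu]_(t in `[0%R, T]) c%:E)%E = (c * T)%:E.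
Proof.
move=> T0; rewrite integral_cst//= lebesgue_measure_itv/= lte_fin.
case: ltP => [_|T0']; first by rewrite oppr0 adde0 EFinM.
by rewrite (le_anti (introT andP (conj T0' T0))) mule0 mulr0.
Qed.

Variable u : 'M[R]_(N, d) -> R.
Hypothesis hu : weak_KAM m u.

Lemma calibrates_velocity gamma T : calibrates m u gamma -> 0 < T ->
  exists2 G, velocity_on T gamma G &
    forall J (t : R), 0 < t -> t <= T -> (u (gamma 0) - u (gamma t))%:E =
      (\int[mu]_(s in `[0%R, t]) turning_lagrangian m J 0 gamma G s)%E.
Proof.
move=> [gac gcal] T0; have [G Gvel] := velocity_exists T0 (gac T T0).
exists G => // J t t0 tT; rewrite gcal//; apply: action_turning_lagrangian => //.
exact: velocity_on_sub Gvel.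
Qed.

Section Plane.
Variable J : 'M[R]_d.
Hypothesis Jtr : J^T = - J.
Hypothesis Jcube : J *m J *m J = - J.

(** Turn the constant curve at x at unit speed: this joins two rotated copies
    of x in time t - s with bounded Lagrangian. *)
Lemma rotation_lipschitz x : (potential m x < +oo)%E -> exists L, forall s t,
  s < t -> `|u (rotate (plane_rot J t) x) - u (rotate (plane_rot J s) x)| <= L * (t - s).
Proof.
move=> xfin.
have [U UE] : exists U, potential m x = U%:E.
  exists (fine (potential m x)); rewrite fineK// ge0_fin_numE//; exact: potential_ge0.
exists (2^-1 * mass_dot m (rotate J x) (rotate J x) + U) => s t st.
have ts : 0 < t - s by rewrite subr_gt0.
have vel : velocity_on (t - s) (fun=> x) (fun=> 0).
  split.
  - by move=> i k; rewrite mxE; exact: integrable0.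
  - move=> y i k _; rewrite [X in _ + X](_ : _ = 0) ?addr0//.
    rewrite /Rintegral; under eq_integral do rewrite mxE.
    by rewrite integral0.
  - by apply: aeW => y _; exact: is_derive_cst.
have bound al be : be ^+ 2 = 1 ->
    u (rotate (plane_rot J al) x) - u (rotate (plane_rot J (al + be * (t - s))) x) <=
    (2^-1 * mass_dot m (rotate J x) (rotate J x) + U) * (t - s).
  move=> be2; rewrite -lee_fin -integral_cst_itv ?(ltW ts)//.
  have H := dominated_turning hm Jtr Jcube hu.1 al be ts
    (abs_cont_on_cst 0 (t - s) x) vel.
  apply: (le_trans H).
  rewrite le_eqVlt; apply/orP; left; apply/eqP; apply: eq_integral => y _; rewrite /turning_lagrangian add0r.
  by rewrite mass_dotZl mass_dotZr mulrA -expr2 be2 mul1r UE.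
(* turning forwards and backwards bounds the difference from both sides *)
have := bound t (-1); have := bound s 1.
rewrite mul1r mulN1r opprB !subrKC expr1n sqrrN expr1n.
by move=> /(_ erefl) h1 /(_ erefl) h2; rewrite ler_norml lerNl opprB h1 h2.
Qed.

Hypothesis zero_momentum : forall gamma, calibrates m u gamma ->
  forall t : R, 0 < t -> mass_dot m (rotate J (gamma t)) (derive1 gamma t) = 0.

(** Let gamma calibrate u from x. Turning gamma so that the rotation, s at time
    0, dies out at time 1 joins R_s x to gamma 1. As the angular momentum
    vanishes, this costs only the quadratic term of the Lagrangian. *)
Lemma rotation_superdiff x : exists K, forall s,
  u (rotate (plane_rot J s) x) - u x <= K * s ^+ 2.
Proof.
have [gamma g0 gcal] := hu.2 x.
have [G Gvel GE] := calibrates_velocity gcal ltr01.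
have gac := gcal.1 1 ltr01.
have Jac := abs_cont_on_rotate J ler01 gac.
have [K K0 Kb] := abs_cont_on_bounded ler01 (abs_cont_on_mass_dot ler01 Jac Jac).
exists (2^-1 * K) => s.
have := dominated_turning hm Jtr Jcube hu.1 s (- s) ltr01 gac Gvel.
rewrite mulr1 subrr plane_rot0 rotate1 g0 => /le_trans step.
rewrite -(lerD2r (u x - u (gamma 1))) subrKA -lee_fin.
rewrite (addrC (2^-1 * K * s ^+ 2)) (EFinD (u x - u (gamma 1))) -{2}g0 (GE J 1)// -[(2^-1 * K * s ^+ 2)]mulr1 -integral_cst_itv//.
rewrite -ge0_integralD//=; last 3 first.
- by move=> t _; exact: turning_lagrangian_ge0.
- by apply: measurable_turning_lagrangian.
- by move=> t _; rewrite lee_fin mulr_ge0 ?sqr_ge0// mulr_ge0.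
apply: (step); apply: ge0_ae_le_integral.
- by move=> t _; exact: turning_lagrangian_ge0.
- move=> t _; rewrite adde_ge0 ?turning_lagrangian_ge0//.
  by rewrite lee_fin mulr_ge0 ?sqr_ge0// mulr_ge0.
have [_ _ Gd] := Gvel.
have : {ae mu, forall t, t \in `[(0:R), 1] -> 0 < t}.
  by apply: ae_itv_cc; apply: aeW => t /andP[].
move: Gd; apply: (@filterS2 _ _ (ae_filter_ringOfSetsType mu)) => t H t0 /= tin.
have [_ dG] := H tin; have t0' := t0 tin.
have := zero_momentum gcal t0'; rewrite derive1E dG => JG0.
have := Kb t; move: tin; rewrite in_itv/= => -> /(_ erefl) Kt.
rewrite /turning_lagrangian scale0r addr0 [leRHS]addeAC leeD2r//.
rewrite -EFinD lee_fin.
set Jg := rotate J (gamma t) in Kt JG0 *.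
rewrite mass_dotDl !mass_dotDr !mass_dotZl !mass_dotZr (mass_dotC m (G t) Jg) JG0.
have : mass_dot m Jg Jg <= K by rewrite (le_trans (ler_norm _)).
move=> /(ler_wpM2l (sqr_ge0 s)); rewrite expr2.
by nra.
Qed.

Lemma rotation_invariant_noncollision x s : (potential m x < +oo)%E -> 0 < s ->
  u (rotate (plane_rot J s) x) = u x.
Proof.
move=> xfin s0; have [L gL] := rotation_lipschitz xfin.
have := @lipschitz_superdiff_const _ (fun s => u (rotate (plane_rot J s) x)) L s s0.
rewrite plane_rot0 rotate1; apply.
  by move=> y z yz; exact: gL.
move=> y; have [K HK] := rotation_superdiff (rotate (plane_rot J y) x).
by exists K => h; rewrite (addrC y) plane_rotD// rotateM; exact: HK.
Qed.

(** A calibrating curve from a collision has finite action, so it passes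
    through a configuration y = gamma t without collision. Rotating it rigidly
    gives u (R_s x) - u (R_s y) <= u x - u y, and u (R_s y) = u y is known. *)
Lemma rotation_invariant_plane x s : u (rotate (plane_rot J s) x) = u x.
Proof.
have cancel (y : 'M[R]_(N, d)) h : rotate (plane_rot J (- h)) (rotate (plane_rot J h) y) = y.
  by rewrite -rotateM -plane_rotD// addNr plane_rot0 rotate1.
have nc y h : (potential m y < +oo)%E -> u (rotate (plane_rot J h) y) = u y.
  move=> yfin; have [h0|h0|<-] := ltgtP 0 h.
  - exact: rotation_invariant_noncollision.
  - rewrite -{2}(cancel y h) [RHS]rotation_invariant_noncollision ?oppr_gt0//.
    by rewrite potential_rotate//; exact: plane_rot_orth.
  - by rewrite plane_rot0 rotate1.
have le y h : u (rotate (plane_rot J h) y) <= u y.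
  have [gamma g0 gcal] := hu.2 y.
  have [G Gvel GE] := calibrates_velocity gcal ltr01.
  have gac := gcal.1 1 ltr01.
  have mL := measurable_turning_lagrangian m J 0 ler01 gac Gvel.
  have intL : mu.-integrable `[0, 1] (turning_lagrangian m J 0 gamma G).
    apply/integrableP; split => //.
    under eq_integral do rewrite gee0_abs ?turning_lagrangian_ge0//.
    by rewrite -(GE J 1)// ltry.
  have [t /andP[t0 t1] tfin] : exists2 t, 0 < t < 1 & (potential m (gamma t) < +oo)%E.
    apply: ae_itv_exists => //.
    have mI : measurable (`[0, 1]%classic : set (measurableTypeR R)) by exact: measurable_itv.
    have [M [mM M0 MP]] := integrable_ae mI intL; exists M; split => // t nfin.
    apply: MP => /= H; apply: nfin => tin.
    have := H tin; rewrite /turning_lagrangian fin_numD => /andP[_].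
    by rewrite ge0_fin_numE//; exact: potential_ge0.
  have := dominated_turning hm Jtr Jcube hu.1 h 0 t0 (gcal.1 t t0)
    (velocity_on_sub (ltW t1) Gvel).
  rewrite -(GE J t) ?(ltW t1)// mul0r addr0 (nc (gamma t))// g0.
  by rewrite lee_fin lerD2r.
apply/eqP; rewrite eq_le le/=.
by rewrite -{1}(cancel x s) le.
Qed.

End Plane.
End Invariance.

(** * Plane rotations generate the special orthogonal group *)

Section SOgen.
Context {R : realType}.

(** The angle that rotates (a, b) onto the nonnegative half of the first
    axis. *)
Lemma polar_angle (a b : R) : exists s,
  cos s * b - sin s * a = 0 /\ 0 <= cos s * a + sin s * b.
Proof.
have ab0 : 0 <= a ^+ 2 + b ^+ 2 by rewrite addr_ge0// sqr_ge0.
pose r := Num.sqrt (a ^+ 2 + b ^+ 2).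
have r2 : r ^+ 2 = a ^+ 2 + b ^+ 2 by rewrite sqr_sqrtr.
have [r0|r0] := eqVneq r 0.
  exists 0; rewrite sin0 cos0 !mul0r !mul1r subr0 addr0.
  have : a ^+ 2 + b ^+ 2 = 0 by rewrite -r2 r0 expr0n.
  move=> /eqP; rewrite paddr_eq0 ?sqr_ge0// !sqrf_eq0 => /andP[/eqP -> /eqP ->].
  by split.
have rp : 0 < r by rewrite lt_neqAle eq_sym r0 sqrtr_ge0.
have c1 : -1 <= a / r <= 1.
  rewrite -ler_norml normrM normfV (gtr0_norm rp) ler_pdivrMr// mul1r.
  by rewrite -sqrtr_sqr ler_wsqrtr// lerDl sqr_ge0.
have [s [cs ss]] : exists s, cos s = a / r /\ sin s = b / r.
  have bE : 1 - (a / r) ^+ 2 = (b / r) ^+ 2.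
    by rewrite !expr_div_n r2; field; rewrite -r2 sqrf_eq0.
  have [b0|b0] := leP 0 b.
    exists (acos (a / r)); rewrite acosK ?in_itv//= sin_acos// bE.
    by rewrite sqrtr_sqr ger0_norm// divr_ge0// ltW.
  exists (- acos (a / r)); rewrite cosN sinN acosK ?in_itv//= sin_acos// bE.
  by rewrite sqrtr_sqr ltr0_norm ?opprK// pmulr_llt0// invr_gt0.
exists s; rewrite cs ss; split; first by field.
rewrite (_ : _ + _ = (a ^+ 2 + b ^+ 2) / r); last by field.
by rewrite divr_ge0// ltW.
Qed.

Variable d : nat.
Implicit Types (theta : 'M[R]_d) (k l : 'I_d).

Lemma plane_rot_mulE k l s theta i j : k != l ->
  (plane_rot (plane_gen k l) s *m theta) i j =
  if i == k then cos s * theta k j + sin s * theta l j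
  else if i == l then cos s * theta l j - sin s * theta k j
  else theta i j.
Proof.
move=> kl; have lk : l != k by rewrite eq_sym.
have Jmul (A : 'M[R]_d) i' j' : (plane_gen k l *m A) i' j' =
    (i' == k)%:R * A l j' - (i' == l)%:R * A k j'.
  rewrite mulmxBl mxE [in X in _ + X]mxE; congr (_ - _).
    rewrite mxE (bigD1 l)//= mxE eqxx andbT big1 ?addr0// => q ql.
    by rewrite mxE (negbTE ql) andbF mul0r.
  rewrite mxE (bigD1 k)//= mxE eqxx andbT big1 ?addr0// => q ql.
  by rewrite mxE (negbTE ql) andbF mul0r.
move: (plane_gen k l) Jmul => J Jmul.
rewrite /plane_rot !mulmxDl mul1mx -!scalemxAl -mulmxA.
rewrite [LHS]mxE [X in _ + X]mxE [X in _ + (X + _)]mxE [X in _ + (_ + X)]mxE.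
rewrite !Jmul !eqxx (negbTE kl) (negbTE lk).
have [->|ik] := eqVneq i k; first by rewrite (negbTE kl) /=; ring.
by have [->|il] := eqVneq i l; rewrite /=; ring.
Qed.

Lemma SO_mul theta1 theta2 : SO d theta1 -> SO d theta2 -> SO d (theta1 *m theta2).
Proof.
move=> [ oth1 dt1] [ oth2 dt2]; split; last by rewrite det_mulmx dt1 dt2 mulr1.
by rewrite trmx_mul mulmxA -(mulmxA theta1) oth2 mulmx1.
Qed.

Lemma orth_col theta j : theta *m theta^T = 1%:M -> \sum_i theta i j ^+ 2 = 1.
Proof.
move=> /mulmx1C /matrixP/(_ j j); rewrite !mxE eqxx /= mulr1n => <-.
by apply: eq_bigr => i _; rewrite mxE expr2.
Qed.

Lemma orth_row theta i : theta *m theta^T = 1%:M -> \sum_j theta i j ^+ 2 = 1.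
Proof.
move=> /matrixP/(_ i i); rewrite !mxE eqxx /= mulr1n => <-.
by apply: eq_bigr => j _; rewrite mxE expr2.
Qed.

Definition block n theta :=
  forall i j : 'I_d, (n <= i)%N || (n <= j)%N -> theta i j = (i == j)%:R.

Variable H : 'M[R]_d -> Prop.
Hypothesis H1 : H 1%:M.
Hypothesis Hplane : forall k l s theta, k != l ->
  H (plane_rot (plane_gen k l) s *m theta) -> H theta.

(** Gaussian elimination by plane rotations: th is reduced one coordinate at a
    time, by clearing the last nontrivial column. The rotation that clears the
    last entry also makes the diagonal entry nonnegative, hence equal to 1 since
    columns have norm 1; the row is then trivial as well. The determinant
    settles the 1 x 1 block that is left. *)
Lemma SO_ind theta : (0 < d)%N -> SO d theta -> H theta.
Proof.
move=> d0 thSO.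
suff Q n : (n < d)%N -> forall th, SO d th -> block n.+1 th -> H th.
  apply: (Q d.-1) => //; first by rewrite prednK.
  move=> i j; rewrite prednK// => /orP[] h'.
    by have := ltn_ord i; rewrite ltnNge h'.
  by have := ltn_ord j; rewrite ltnNge h'.
elim: n => [|n IH] nd th thS thB.
  pose o : 'I_d := Ordinal nd.
  have thE i j : ~~ ((i == o) && (j == o)) -> th i j = (i == j)%:R.
    move=> ij; apply: thB; rewrite !lt0n; move: ij; rewrite negb_and.
    by rewrite -!val_eqE.
  have th1 : th o o = 1.
    have [_ <-] := thS; rewrite det_trig.
      rewrite (bigD1 o)//= big1 ?mulr1// => i io.
      by rewrite thE ?eqxx// negb_and io.
    apply/is_trig_mxP => i j ij; rewrite thE.
      by rewrite -val_eqE/= ltn_eqF.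
    rewrite negb_and; apply/orP; right; rewrite -val_eqE/= -lt0n.
    exact: leq_ltn_trans ij.
  suff -> : th = 1%:M by [].
  apply/matrixP => i j; rewrite mxE.
  have [/andP[/eqP -> /eqP ->]|ij] := boolP ((i == o) && (j == o)).
    by rewrite th1 eqxx.
  by rewrite thE.
pose p : 'I_d := Ordinal nd.
(* the first h entries of column p are already cleared, and the last clearing
   rotation has fixed the sign of the diagonal entry *)
suff Q (h : nat) : (h <= n.+1)%N -> forall th, SO d th -> block n.+2 th ->
    (forall l : 'I_d, (l < h)%N -> th l p = 0) ->
    (h = n.+1 -> 0 <= th p p) -> H th.
  by apply: (Q 0 _ th thS thB).
move=> hn; rewrite -(subKn hn); move: (n.+1 - h)%N (leq_subr h n.+1) => {hn}k.
elim: k => [_ {thS thB}th thS thB th0 thp|k IHk kn {thS thB}th thS thB th0 _].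
  rewrite subn0 in th0 thp.
  have thcol l : l != p -> th l p = 0.
    move=> lp; have [/th0//|nl] := ltnP l n.+1.
    rewrite thB ?(negbTE lp)//.
    by apply/orP; left; rewrite ltn_neqAle nl andbT eq_sym; move: lp; rewrite -val_eqE.
  have thpp : th p p = 1.
    have := orth_col p thS.1; rewrite (bigD1 p)//= big1 ?addr0; last first.
      by move=> i ip; rewrite thcol// expr0n.
    move=> /eqP; rewrite sqrf_eq1 => /orP[/eqP //|/eqP E].
    by have := thp erefl; rewrite E oppr_ge0 ler10.
  have throw j : j != p -> th p j = 0.
    move=> jp; have := orth_row p thS.1; rewrite (bigD1 p)//= thpp expr1n.
    rewrite -[RHS]addr0 => /addrI/psumr_eq0P.
    by move=> /(_ (fun i _ => sqr_ge0 _) j jp)/eqP; rewrite sqrf_eq0 => /eqP.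
  apply: (IH (ltnW nd) th thS) => i j ij.
  have [->|ip] := eqVneq i p.
    have [->|jp] := eqVneq j p; first by rewrite thpp.
    by rewrite throw.
  have [->|jp] := eqVneq j p; first by rewrite thcol// (negbTE ip).
  apply: thB; move: ij ip jp; rewrite -!val_eqE/= !(eq_sym _ n.+1).
  by move=> /orP[ge|ge] ip jp; apply/orP; [left|right]; rewrite ltn_neqAle ge ?ip ?jp.
have kd : (n.+1 - k.+1 < d)%N by apply: leq_ltn_trans (leq_subr _ _) nd.
pose q : 'I_d := Ordinal kd.
have qp : (q < p)%N by rewrite /= ltn_subrL.
have pq : p != q by rewrite -val_eqE gtn_eqF.
have [s [s0 s1]] := polar_angle (th p p) (th q p).
apply: (Hplane (s := s) pq); apply: IHk; first exact: ltnW.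
- apply: SO_mul => //; apply: plane_rot_SO; first exact: plane_gen_tr.
  exact: plane_gen_cube.
- move=> i j ij; rewrite plane_rot_mulE//.
  move: ij; have [->|ip] := eqVneq i p => ij.
    have jn : (n.+2 <= j)%N by move: ij => /orP[|//]; rewrite /= ltnn.
    have jp : p != j by rewrite -val_eqE ltn_eqF.
    have jq : q != j by rewrite -val_eqE ltn_eqF// (ltn_trans qp).
    by rewrite !thB ?jn ?orbT// (negbTE jp) (negbTE jq) !mulr0 addr0.
  move: ij; have [->|iq] := eqVneq i q => ij.
    have jn : (n.+2 <= j)%N.
      by move: ij => /orP[|//]; rewrite leqNgt (ltn_trans qp).
    have jp : p != j by rewrite -val_eqE ltn_eqF.
    have jq : q != j by rewrite -val_eqE ltn_eqF// (ltn_trans qp).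
    by rewrite !thB ?jn ?orbT// (negbTE jp) (negbTE jq) !mulr0 subr0.
  exact: thB.
- move=> l lk; rewrite plane_rot_mulE//.
  have lp : l != p.
    rewrite -val_eqE ltn_eqF// (leq_trans lk)// leq_subr//.
  rewrite (negbTE lp); have [_|lq] := eqVneq l q; first exact: s0.
  apply: th0; rewrite ltn_neqAle; move: lq; rewrite -val_eqE/= => ->/=.
  by move: lk; rewrite -(subnSK kn) ltnS.
- by move=> _; rewrite plane_rot_mulE// eqxx.
Qed.

End SOgen.

(** * From rotation invariance to zero angular momentum *)

Section Converse.
Context {R : realType}.
Variables (N d : nat) (m : 'I_N -> R).
Hypothesis hm : forall i : 'I_N, 0 < m i.
Notation mu := (@lebesgue_measure R).
Implicit Types (gamma G X : R -> 'M[R]_(N, d)) (T : R).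

Lemma integrable_EFinZl (A : set (measurableTypeR R)) (c : R) (f : R -> R) :
  measurable A -> mu.-integrable A (EFin \o f) ->
  mu.-integrable A (EFin \o (fun t => c * f t)).
Proof.
move=> mA fint; have -> : EFin \o (fun t => c * f t) = (fun t => c%:E * (f t)%:E)%E.
  by apply/funext => t /=; rewrite EFinM.
exact: (integrableZl mA c fint).
Qed.

Lemma integrable_EFin_sum (A : set (measurableTypeR R)) (I : Type) (s : seq I) (f : I -> R -> R) :
  measurable A -> (forall i, mu.-integrable A (EFin \o f i)) ->
  mu.-integrable A (EFin \o (fun t => \sum_(i <- s) f i t)).
Proof.
move=> mA fint.
have -> : EFin \o (fun t => \sum_(i <- s) f i t) =
    (fun t => \sum_(i <- s) (f i t)%:E)%E.
  by apply/funext => t /=; rewrite sumEFin.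
by apply: (integrable_sum mA) => i _; exact: fint.
Qed.

Lemma Rintegral_sum (A : set (measurableTypeR R)) (I : Type) (s : seq I) (f : I -> R -> R) :
  measurable A -> (forall i, mu.-integrable A (EFin \o f i)) ->
  \int[mu]_(t in A) (\sum_(i <- s) f i t) = \sum_(i <- s) \int[mu]_(t in A) f i t.
Proof.
move=> mA fint; elim: s => [|i s IH].
  rewrite big_nil /Rintegral; under eq_integral do rewrite big_nil.
  by rewrite integral0.
rewrite big_cons -IH -RintegralD//; last exact: integrable_EFin_sum.
by apply: eq_Rintegral => t _; rewrite big_cons.
Qed.

Lemma integrable_mass_dot (A : set (measurableTypeR R)) X G : measurable A ->
  (forall i k, measurable_fun A (fun t => X t i k)) ->
  (forall i k, exists M : R, forall t, A t -> `|X t i k| <= M) ->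
  (forall i k, mu.-integrable A (EFin \o (fun t => G t i k))) ->
  mu.-integrable A (EFin \o (fun t => mass_dot m (X t) (G t))).
Proof.
move=> mA mX bX Gint.
have -> : EFin \o (fun t => mass_dot m (X t) (G t)) =
    EFin \o (fun t => \sum_i \sum_k m i * X t i k * G t i k).
  apply/funext => t; congr EFin; rewrite /= mass_dotEs; apply: eq_bigr => i _.
  by rewrite mulr_sumr; apply: eq_bigr => k _; rewrite mulrA.
apply: integrable_EFin_sum => // i; apply: integrable_EFin_sum => // k.
have -> : EFin \o (fun t => m i * X t i k * G t i k) =
    (fun t => (m i * X t i k)%:E * (G t i k)%:E)%E.
  by apply/funext => t /=; rewrite EFinM.
apply: (@integrableMr _ _ _ mu A mA (fun t => m i * X t i k)
  (fun t => (G t i k)%:E)); [exact: measurable_funM| |exact: Gint].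
have [M XM] := bX i k; exists (m i * M); split; first exact: num_real.
move=> M' M'lt t At /=; apply: le_trans (ltW M'lt).
by rewrite normrM gtr0_norm// ler_pM2l// XM.
Qed.

Lemma Rintegral_mass_dot (A : set (measurableTypeR R)) (Z : 'M[R]_(N, d)) G : measurable A ->
  (forall i k, mu.-integrable A (EFin \o (fun t => G t i k))) ->
  \int[mu]_(t in A) mass_dot m Z (G t) =
  mass_dot m Z (\matrix_(i, k) \int[mu]_(t in A) G t i k).
Proof.
move=> mA Gint.
have int1 i k : mu.-integrable A (EFin \o (fun t => Z i k * G t i k)).
  exact: integrable_EFinZl.
have int2 i : mu.-integrable A (EFin \o (fun t => \sum_k Z i k * G t i k)).
  exact: integrable_EFin_sum.
rewrite mass_dotEs.
under eq_Rintegral do rewrite mass_dotEs.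
rewrite Rintegral_sum//; last by move=> i; exact: integrable_EFinZl.
apply: eq_bigr => i _; rewrite RintegralZl//; congr (_ * _).
rewrite Rintegral_sum//; apply: eq_bigr => k _.
by rewrite RintegralZl// mxE.
Qed.

Lemma norm_mass_dot_le (X Y : 'M[R]_(N, d)) :
  `|mass_dot m X Y| <= (\sum_i m i) * `|X| * \sum_i \sum_k `|Y i k|.
Proof.
rewrite mass_dotEs (le_trans (ler_norm_sum _ _ _))//.
rewrite -mulrA mulr_suml; apply: ler_sum => i _.
rewrite normrM gtr0_norm// ler_pM2l//.
rewrite (le_trans (ler_norm_sum _ _ _))// (bigD1 i)//= mulrDr ler_wpDr//.
  by rewrite mulr_ge0//; apply: sumr_ge0 => *; apply: sumr_ge0.
rewrite mulr_sumr; apply: ler_sum => k _.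
by rewrite normrM ler_wpM2r// le_entry_mx_norm.
Qed.

Lemma norm_rotate_le (theta : 'M[R]_d) (X : 'M[R]_(N, d)) :
  `|rotate theta X| <= d%:R * `|theta| * `|X|.
Proof.
rewrite [leLHS]/Num.Def.normr/= mx_normrE; apply: bigmax_le.
  by rewrite !mulr_ge0.
move=> [i k] _; rewrite mxE (le_trans (ler_norm_sum _ _ _))//.
have -> : d%:R * `|theta| * `|X| = \sum_(l < d) (`|theta| * `|X|).
  by rewrite sumr_const card_ord -mulrA mulr_natl.
apply: ler_sum => l _; rewrite normrM mulrC mxE.
by rewrite ler_pM// le_entry_mx_norm.
Qed.

Lemma quadratic_ge0_eq0 (I K : R) : (forall b, 0 <= b * I + b ^+ 2 * K) -> I = 0.
Proof.
move=> H; apply/eqP/negPn/negP => I0.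
have K1 : 0 < `|K| + 1 by rewrite ltr_pwDr.
(* the minimizer of the polynomial is - I / (2 K); this value of b also suits
   K <= 0 *)
have := H (- I / (`|K| + 1)).
rewrite (_ : _ + _ = I ^+ 2 / (`|K| + 1) ^+ 2 * (K - `|K| - 1)); last first.
  by field; rewrite gt_eqF.
rewrite leNgt => /negP; apply; rewrite nmulr_llt0.
  by rewrite pmulr_rgt0 ?exprn_even_gt0// invr_gt0 exprn_gt0.
by have := ler_norm K; lra.
Qed.

Variable u : 'M[R]_(N, d) -> R.
Hypothesis udom : dominated m u.
Variable J : 'M[R]_d.
Hypothesis Jtr : J^T = - J.
Hypothesis Jcube : J *m J *m J = - J.
Hypothesis uinv : forall s x, u (rotate (plane_rot J s) x) = u x.

Section AlongCurve.
Variables (gamma G : R -> 'M[R]_(N, d)) (T : R).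
Hypothesis T0 : 0 < T.
Hypothesis gac : abs_cont_on 0 T gamma.
Hypothesis Gvel : velocity_on T gamma G.
Hypothesis gcal : forall t, 0 < t -> t <= T -> (u (gamma 0) - u (gamma t))%:E =
  (\int[mu]_(s in `[0%R, t]) turning_lagrangian m J 0 gamma G s)%E.

Let Gint (A : set (measurableTypeR R)) i k : measurable A ->
  mu.-integrable A (EFin \o (fun t => G t i k)).
Proof. by move=> mA; case: Gvel => Gi _ _; exact: (integrableS measurableT) (Gi i k). Qed.

Let Jg t := rotate J (gamma t).

Let Jg_ac : abs_cont_on 0 T Jg.
Proof. exact: abs_cont_on_rotate (ltW T0) gac. Qed.

Lemma integrable_torque t : t <= T ->
  mu.-integrable `[0, t] (EFin \o (fun s => mass_dot m (Jg s) (G s))).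
Proof.
move=> tT; apply: integrable_mass_dot => //.
- move=> i k; apply: measurable_funS (measurable_abs_cont (ltW T0) (abs_cont_on_entry i k Jg_ac)) => //.
  by apply: subset_itvl; rewrite bnd_simp.
- move=> i k; have [M M0 HM] := abs_cont_on_bounded (ltW T0) (abs_cont_on_entry i k Jg_ac).
  exists M => s; rewrite /= in_itv/= => /andP[s0 st].
  by apply: HM; rewrite s0 (le_trans st).
- by move=> i k; exact: Gint.
Qed.

(** Both ends of the turned curve have the u-values of the ends of gamma, so
    gamma, which calibrates u, costs at most as much as the turned curve for
    every angular velocity be; hence the term linear in be vanishes. *)
Lemma integral_torque t : 0 < t -> t <= T ->
  \int[mu]_(s in `[0, t]) mass_dot m (Jg s) (G s) = 0.
Proof.
move=> t0 tT.
pose c s := mass_dot m (Jg s) (G s); pose Q s := mass_dot m (Jg s) (Jg s).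
have cint : mu.-integrable `[0, t] (EFin \o c) := integrable_torque tT.
have mt : measurable (`[0, t]%classic : set (measurableTypeR R)) by exact: measurable_itv.
have Qac : abs_cont_on 0 T Q by apply: abs_cont_on_mass_dot => //; exact: ltW.
have Qint : mu.-integrable `[0, t] (EFin \o Q).
  apply: measurable_bounded_integrable => //.
  - by rewrite /= lebesgue_measure_itv/=; case: ifP; rewrite ?ltry// -EFinB ltry.
  - apply: measurable_funS (measurable_abs_cont (ltW T0) Qac) => //.
    by apply: subset_itvl; rewrite bnd_simp.
  - have [M M0 HM] := abs_cont_on_bounded (ltW T0) Qac.
    exists M; split; first exact: num_real.
    move=> M' M'lt s /=; rewrite in_itv/= => /andP[s0 st].
    by apply: le_trans (ltW M'lt); apply: HM; rewrite s0 (le_trans st).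
have Lint : mu.-integrable `[0, t] (turning_lagrangian m J 0 gamma G).
  apply/integrableP; split.
    apply: measurable_funS (measurable_turning_lagrangian m J 0 (ltW T0) gac Gvel) => //.
    by apply: subset_itvl; rewrite bnd_simp.
  under eq_integral do rewrite gee0_abs ?turning_lagrangian_ge0//.
  by rewrite -gcal// ltry.
apply: (@quadratic_ge0_eq0 _ (2^-1 * \int[mu]_(s in `[0, t]) Q s)) => be.
have pint : mu.-integrable `[0, t] (EFin \o (fun s => be * c s + (be ^+ 2 * 2^-1) * Q s)).
  have -> : EFin \o (fun s => be * c s + (be ^+ 2 * 2^-1) * Q s) =
    ((EFin \o (fun s => be * c s)%R) \+ (EFin \o (fun s => (be ^+ 2 * 2^-1) * Q s)%R))%E.
    by apply/funext => s.
  by apply: integrableD => //; exact: integrable_EFinZl.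
have := dominated_turning hm Jtr Jcube udom 0 be t0 (abs_cont_on_sub (lexx 0) tT gac) (velocity_on_sub tT Gvel).
rewrite uinv uinv gcal// => le.
have : (\int[mu]_(s in `[0%R, t]) turning_lagrangian m J be gamma G s =
  \int[mu]_(s in `[0%R, t]) turning_lagrangian m J 0 gamma G s +
  \int[mu]_(s in `[0%R, t]) (be * c s + (be ^+ 2 * 2^-1) * Q s)%:E)%E.
  rewrite -integralD//; apply: eq_integral => s _.
  rewrite /turning_lagrangian scale0r addr0 addeAC -EFinD; congr (_%:E + _)%E.
  rewrite mass_dotDl !mass_dotDr !mass_dotZl !mass_dotZr (mass_dotC m (G s)).
  by rewrite /c /Q /Jg; field.
move=> E; move: le; rewrite E -gcal//.
rewrite -(fineK (integrable_fin_num mt pint)) -EFinD lee_fin lerDl.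
rewrite -/(Rintegral mu _ _) RintegralD//; try exact: integrable_EFinZl.
by rewrite !RintegralZl// -mulrA.
Qed.

(** As the torque integrates to 0 over every interval,
      J gamma(t0) . (gamma(t0 + h) - gamma(t0))
        = int over (t0, t0 + h] of (J gamma(t0) - J gamma(s)) . G(s) ds.
    The first factor of the integrand is O(h) because gamma is differentiable at
    t0, and the integral of |G| over the interval tends to 0: the left-hand side
    is o(h). *)
Lemma torque_eq0 t0 D : 0 < t0 < T -> is_derive t0 (1 : R) gamma D ->
  mass_dot m (Jg t0) D = 0.
Proof.
move=> /andP[t00 t0T] [dg gD].
pose M := \sum_i m i; pose C := d%:R * `|J| * (`|D| + 1).
have M0 : 0 <= M by apply: sumr_ge0 => i _; exact: ltW.
have C0 : 0 <= C by rewrite !mulr_ge0// addr_ge0.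
pose g s := \sum_i \sum_k `|G s i k|.
have gint (A : set (measurableTypeR R)) : measurable A -> mu.-integrable A (EFin \o g).
  move=> mA; apply: integrable_EFin_sum => // i; apply: integrable_EFin_sum => // k.
  have -> : EFin \o (fun t => `|G t i k|) = (abse \o (EFin \o (fun t => G t i k))).
    by apply/funext.
  by apply: integrable_abse; exact: Gint.
pose Phi x := \int[mu]_(s in `[0, x]) g s.
have Phi_cont : {for t0, continuous Phi}.
  have := @parameterized_integral_continuous _ 0 T g (ltW T0) (gint _ (measurable_itv _)).
  move=> /(continuous_within_itvP _ T0)[+ _ _]; apply.
  by rewrite in_itv/= t00.
have slope e : 0 < e -> exists2 r, 0 < r & forall h, 0 < h -> h < r ->
    `|D - h^-1 *: (gamma (t0 + h) - gamma t0)| < e.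
  move=> e0; have := dg; rewrite /derivable => /cvgrPdist_lt.
  rewrite -/(derive gamma t0 1) gD => /(_ _ e0)[r /= r0 H]; exists r => // h h0 hr.
  have := H h; rewrite /ball_/= sub0r normrN gtr0_norm// gt_eqF// => /(_ hr isT).
  by rewrite /GRing.scale/= mulr1 (addrC h).
have key h : 0 < h -> t0 + h <= T ->
    (forall s, t0 < s -> s <= t0 + h -> `|gamma s - gamma t0| <= (`|D| + 1) * h) ->
    `|mass_dot m (Jg t0) (gamma (t0 + h) - gamma t0)| <=
      h * (M * C * (Phi (t0 + h) - Phi t0)).
  move=> h0 hT near_t0.
  pose A := `]t0, (t0 + h)]%classic : set (measurableTypeR R).
  have mA : measurable A by exact: measurable_itv.
  have incr (f : R -> R) : mu.-integrable `[0, t0 + h] (EFin \o f) ->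
      \int[mu]_(s in `[0, t0 + h]) f s - \int[mu]_(s in `[0, t0]) f s =
      \int[mu]_(s in A) f s.
    move=> fint; rewrite (Rintegral_itvB fint)//.
      by rewrite bnd_simp ltW.
    by rewrite bnd_simp lerDl ltW.
  have int1 : mu.-integrable A (EFin \o (fun s => mass_dot m (Jg t0) (G s))).
    apply: integrable_mass_dot => // i k; last exact: Gint.
    by exists `|Jg t0 i k|.
  have int2 : mu.-integrable A (EFin \o (fun s => mass_dot m (Jg s) (G s))).
    apply: integrableS (integrable_torque hT) => //.
    by move=> s; rewrite /A /= !in_itv/= => /andP[s1 ->]; rewrite (ltW (lt_trans t00 s1)).
  have E1 : mass_dot m (Jg t0) (gamma (t0 + h) - gamma t0) =
      \int[mu]_(s in A) mass_dot m (Jg t0) (G s).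
    rewrite Rintegral_mass_dot//; last by move=> i k; exact: Gint.
    congr (mass_dot m _ _); apply/matrixP => i k; rewrite !mxE.
    rewrite -incr; last exact: Gint.
    have [_ gE _] := Gvel.
    rewrite gE; last by rewrite hT addr_ge0// ltW.
    rewrite [gamma t0 i k]gE; last by rewrite !ltW.
    by rewrite opprD addrACA subrr add0r.
  have E2 : \int[mu]_(s in A) mass_dot m (Jg s) (G s) = 0.
    rewrite -incr; last exact: integrable_torque.
    by rewrite !integral_torque// ?subrr// ?ltW// addr_gt0.
  have -> : mass_dot m (Jg t0) (gamma (t0 + h) - gamma t0) =
      \int[mu]_(s in A) (mass_dot m (Jg t0) (G s) - mass_dot m (Jg s) (G s)).
    by rewrite RintegralB// E2 subr0.
  have int3 : mu.-integrable A (EFin \o (fun s => mass_dot m (Jg t0) (G s) - mass_dot m (Jg s) (G s))).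
    rewrite (_ : EFin \o _ = (EFin \o (fun s => mass_dot m (Jg t0) (G s))) \-
      (EFin \o (fun s => mass_dot m (Jg s) (G s))))%E; last by apply/funext.
    exact: integrableB.
  apply: le_trans (le_normr_Rintegral mA int3) _.
  rewrite incr; last exact: gint.
  rewrite mulrA -RintegralZl//; last exact: gint.
  apply: le_Rintegral => //.
  - rewrite (_ : EFin \o _ = abse \o (EFin \o (fun s => mass_dot m (Jg t0) (G s) - mass_dot m (Jg s) (G s)))); last by apply/funext.
    exact: integrable_abse.
  - by apply: integrable_EFinZl => //; exact: gint.
  move=> s; rewrite /A /= in_itv/= => /andP[s1 s2].
  rewrite -mass_dotNl -mass_dotDl (le_trans (norm_mass_dot_le _ _))// ler_wpM2r//.
    by apply: sumr_ge0 => *; apply: sumr_ge0.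
  rewrite mulrCA ler_wpM2l//.
  rewrite /Jg /rotate -mulmxBl -/(rotate J _) (le_trans (norm_rotate_le _ _))//.
  rewrite /C [leRHS]mulrC -[leRHS]mulrA ler_wpM2l ?mulr_ge0// distrC.
  exact: near_t0.
apply/eqP; rewrite -normr_le0; apply/ler_addgt0Pr => e e0; rewrite add0r.
pose K1 := M * `|Jg t0| * (N * d)%:R + 1.
have K10 : 0 < K1 by rewrite ltr_pwDr// !mulr_ge0.
pose K2 := M * C + 1.
have K20 : 0 < K2 by rewrite ltr_pwDr// mulr_ge0.
have [r1 r10 H1] := slope 1 ltr01.
have [r2 r20 H2] := slope (e / 2 / K1) (divr_gt0 (divr_gt0 e0 (ltr0Sn _ 1)) K10).
have [r3 r30 H3] : exists2 r, 0 < r & forall h, 0 < h -> h < r ->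
    `|Phi t0 - Phi (t0 + h)| < e / 2 / K2.
  have := Phi_cont => /cvgrPdist_lt /(_ (e / 2 / K2)).
  rewrite !divr_gt0// => /(_ isT)[r /= r0 H]; exists r => // h h0 hr.
  by apply: H; rewrite /ball_/= opprD addNKr normrN gtr0_norm.
pose h := Num.min (Num.min r1 (T - t0)) (Num.min r2 r3) / 2.
have h0 : 0 < h by rewrite divr_gt0// !lt_min r10 subr_gt0 t0T r20.
have hlt : [/\ h < r1, h < T - t0, h < r2 & h < r3].
  have : h < Num.min (Num.min r1 (T - t0)) (Num.min r2 r3).
    by rewrite /h ltr_pdivrMr// ltr_pMr ?ltr1n// !lt_min r10 subr_gt0 t0T r20.
  by rewrite !lt_min => /andP[/andP[-> ->] /andP[-> ->]].
have [h1 hT h2 h3] := hlt.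
have near1 s : t0 < s -> s <= t0 + h -> `|gamma s - gamma t0| <= (`|D| + 1) * h.
  move=> ts sh; have st0 : 0 < s - t0 by rewrite subr_gt0.
  have sh' : s - t0 <= h by rewrite lerBlDl.
  have := H1 (s - t0) st0 (le_lt_trans sh' h1); rewrite subrKC => Dlt.
  have -> : gamma s - gamma t0 = (s - t0) *: ((s - t0)^-1 *: (gamma s - gamma t0)).
    by rewrite scalerA divff ?gt_eqF// scale1r.
  rewrite normrZ gtr0_norm// mulrC ler_pM//; first exact: ltW.
  rewrite -[X in `|X|](subrKC D) (le_trans (ler_normD _ _))// lerD2l.
  by rewrite distrC ltW.
have hT' : t0 + h <= T by rewrite addrC -lerBrDr ltW.
have kh := key h h0 hT' near1.
have -> : mass_dot m (Jg t0) D =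
    mass_dot m (Jg t0) (D - h^-1 *: (gamma (t0 + h) - gamma t0)) +
    h^-1 * mass_dot m (Jg t0) (gamma (t0 + h) - gamma t0).
  by rewrite -mass_dotZr -mass_dotDr subrK.
rewrite (le_trans (ler_normD _ _))// [e]splitr lerD//.
  rewrite (le_trans (norm_mass_dot_le _ _))//.
  set Y := D - _.
  apply: (@le_trans _ _ (K1 * `|Y|)).
    apply: (@le_trans _ _ (M * `|Jg t0| * ((N * d)%:R * `|Y|))).
      rewrite ler_wpM2l ?mulr_ge0//.
      apply: (@le_trans _ _ (\sum_(i < N) \sum_(k < d) `|Y|)).
        by apply: ler_sum => i _; apply: ler_sum => k _; exact: le_entry_mx_norm.
      by rewrite !sumr_const !card_ord -mulrnA mulnC mulr_natl.
    by rewrite mulrA ler_wpM2r// lerDl.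
  by rewrite mulrC -ler_pdivlMr// ltW// H2.
rewrite normrM gtr0_norm ?invr_gt0// ler_pdivrMl// (le_trans kh)// ler_pM2l//.
apply: (@le_trans _ _ (K2 * `|Phi t0 - Phi (t0 + h)|)).
  rewrite distrC; apply: (@le_trans _ _ (M * C * `|Phi (t0 + h) - Phi t0|)).
    by rewrite ler_wpM2l ?mulr_ge0// ler_norm.
  by rewrite ler_wpM2r// lerDl.
by rewrite mulrC -ler_pdivlMr// ltW// H3.
Qed.

End AlongCurve.

End Converse.

(** * The characterization of rotation invariance *)

(** A limit that does not exist takes the default value, which is 0. *)
Lemma derive1_nonderivable (R : realType) N d (gamma : R -> 'M[R]_(N, d)) (t : R) :
  ~ derivable gamma t 1 -> derive1 gamma t = 0.
Proof.
move=> nd; rewrite derive1E /derive (dvgP nd).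
by apply/matrixP => i k; rewrite !mxE.
Qed.

Theorem theorem1 (R : realType) (N d : nat) (hd : (2 <= d)%N)
    (m : 'I_N -> R) (hm : forall i : 'I_N, 0 < m i)
    (u : 'M[R]_(N, d) -> R) (hu : weak_KAM m u) :
  (forall theta : 'M[R]_d, SO d theta ->
     forall x : 'M[R]_(N, d), u x = u (rotate theta x)) <->
  (forall gamma : R -> 'M[R]_(N, d), calibrates m u gamma ->
     forall t : R, 0 < t -> angular_momentum m (gamma t) (derive1 gamma t) = 0).
Proof.
split=> [uinv gamma gcal t t0|zero theta thSO x].
  apply/matrixP => k l; rewrite angular_momentum_gen mxE.
  have [->|kl] := eqVneq k l.
    by rewrite /plane_gen subrr /rotate trmx0 mulmx0 -(scale0r 0) mass_dotZl mul0r oppr0.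
  have [dg|/derive1_nonderivable ->] := pselect (derivable gamma t 1); last first.
    by rewrite -(scale0r 0) mass_dotZr mul0r oppr0.
  have tT : 0 < t < t + 1 by rewrite t0 ltrDl ltr01.
  have T0 : 0 < t + 1 by rewrite addr_gt0.
  have [G Gvel GE] := calibrates_velocity hm gcal T0.
  have Jtr := @plane_gen_tr R _ k l; have Jcube := @plane_gen_cube R _ k l kl.
  have dis : is_derive t (1 : R) gamma (derive1 gamma t).
    by apply: DeriveDef => //; rewrite derive1E.
  have uinvJ s y : u (rotate (plane_rot (plane_gen k l) s) y) = u y.
    by rewrite -uinv//; exact: plane_rot_SO.
  apply/eqP; rewrite oppr_eq0; apply/eqP.
  exact: (torque_eq0 hm hu.1 Jtr Jcube uinvJ T0 (gcal.1 _ T0) Gvel (GE _) tT dis).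
symmetry; move: x; apply: (SO_ind (H := fun th => forall x, u (rotate th x) = u x)).
- by move=> y; rewrite rotate1.
- move=> k l s th kl uth y.
  have Jtr := @plane_gen_tr R _ k l; have Jcube := @plane_gen_cube R _ k l kl.
  rewrite -(uth y) rotateM; apply/esym.
  apply: (rotation_invariant_plane hm hu Jtr Jcube) => gamma gcal t t0.
  apply/eqP; rewrite -oppr_eq0 -angular_momentum_gen zero//.
  by rewrite mxE.
- exact: leq_trans hd.
- exact: thSO.
Qed.
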